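(* The following continued fraction converges and \[ \left(\frac{\Gamma(1/4)}{\Gamma(3/4)}\right)^4 =80-\cfrac{160}{47+\cfrac{3^4}{44\cdot2^2+1+\cfrac{5^4}{44\cdot3^2+1+\cfrac{7^4}{44\cdot4^2+1+\cdots}}}}, \] that is, the value is $a(0)+\cfrac{b(0)}{a(1)+\cfrac{b(1)}{a(2)+\cdots}}$ with $a(0)=80$, $a(1)=47$, $a(n)=44n^2+1$ for $n\ge2$, $b(0)=-160$, and $b(n)=(2n+1)^4$ for $n\ge1$. Moreover, if $p(n)/q(n)$ denotes the $n$-th convergent, then as $n\to\infty$ \[ \left(\frac{\Gamma(1/4)}{\Gamma(3/4)}\right)^4-\frac{p(n)}{q(n)}\sim(-1)^{n+1}\frac{8\,(\Gamma(1/4)/\Gamma(3/4))^4}{\big((1+\sqrt5)/2\big)^{10n+10}}. \]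
   Context: For sequences $a(n),b(n)$, the $n$-th convergent $p(n)/q(n)$ of the continued fraction $a(0)+\cfrac{b(0)}{a(1)+\cfrac{b(1)}{a(2)+\cdots}}$ is the finite truncation $a(0)+\cfrac{b(0)}{a(1)+\cfrac{b(1)}{\ddots+\cfrac{b(n-1)}{a(n)}}}$. *)

(* Defs.v *)
From Stdlib Require Import Reals.
From Coquelicot Require Import Coquelicot.
Open Scope R_scope.

Definition Gamma (s : R) : R :=
  RInt_gen (fun t => Rpower t (s - 1) * exp (- t))
           (at_right 0) (Rbar_locally p_infty).

Fixpoint cf_from (a b : nat -> R) (k m : nat) : R :=
  match m with
  | O => a k
  | S m' => a k + b k / cf_from a b (S k) m'
  end.

Definition convergent (a b : nat -> R) (n : nat) : R := cf_from a b 0 n.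

Definition a_cf (n : nat) : R :=
  match n with
  | O => 80
  | S O => 47
  | _ => 44 * (INR n) ^ 2 + 1
  end.

Definition b_cf (n : nat) : R :=
  match n with
  | O => -160
  | _ => (2 * INR n + 1) ^ 4
  end.

Definition golden : R := (1 + sqrt 5) / 2.

(* Main.v *)
(* The continued fraction is Apery's recurrence for zeta(2), shifted to half-integers.  With
   P_0 = 0, P_1 = 80, Q_0 = 2, Q_1 = 1, numerators and denominators are solutions of
     u_(j+2) = (44 (j+1)^2 + 1) u_(j+1) + (2j+1)^4 u_j.
   Up to the factor (-1)^j (1^2 3^2 ... (2j-1)^2) its minimal solution is Beukers' integral
     I(j) = pi^-2 * iint (x (1-x) y (1-y) / (1 - x y))^(j - 1/2) dx dy / (1 - x y),
   which we use in the form of a series [sI j] of positive hypergeometric terms.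

   Value.  The companion series X(l) = pi^-2 * iint ((1-x) (1-y) / (1 - x y))^l dx dy / w, where
   w^2 = x y (1-x) (1-y) (1 - x y), satisfies the same two-step recurrence as
   h(l)^2 = (Gamma (a/2) / Gamma ((a+1)/2))^2, a = l + 1/2, so the two are proportional.  As
   I(0) = X(0) and 2 I(1) + I(0) = 5 X(1), this identifies P - G Q with a multiple of the minimal
   solution.

   Asymptotics.  Laplace's method for the series gives j phi^(5j) I(j) -> const: near its peak the
   series is compared term by term with a Poisson distribution of the same variance, Chebyshev's
   inequality (from a telescoping identity) disposes of the rest, and Stirling's formula evaluates
   the peak.  The Casoratian of Q and the minimal solution then gives the asymptotics of Q. *)

Require Import Defs.
From Stdlib Require Import Reals Lra Lia Psatz Factorial ZArith.
From Coquelicot Require Import Coquelicot.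
Open Scope R_scope.

(** * The two hypergeometric series *)

(** The integrals only serve to find the two series. Every identity between series is proved by
    telescoping with an explicit rational certificate, and the value is settled by comparing two
    solutions of the recurrence at the indices 0 and 1. Stirling's constant is carried as an
    abstract limit [c]. The companion series is [exp (- (2 * c))] times the squared Gamma quotient,
    the squared Laplace constant contains [exp (- (2 * c)) ^ 2], and the two cancel in the last
    limit. A Poisson distribution is chosen for the comparison because its consecutive ratios are
    rational like those of [tI n], its total mass is exactly an exponential, and its variance obeys
    a telescoping identity of the same kind. Divided by the minimal solution, the Casoratian
    identity becomes a first-order recurrence for [dom_ratio]. Scaled by [golden ^ (10 * j)], it is
    a contraction towards a fixed point, which yields the exact constant. Convergence of the
    continued fraction is then read off from the relative asymptotics of the error. *)

Lemma le_div_r a b c : 0 < c -> a * c <= b -> a <= b / c.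
Proof. intros Hc. apply Rle_div_r, Hc. Qed.

Lemma div_le_l a b c : 0 < c -> a <= b * c -> a / c <= b.
Proof. intros Hc. apply Rle_div_l, Hc. Qed.

(** The Pochhammer symbol (1/2)_k, equal to Gamma(k + 1/2) / sqrt pi. *)
Fixpoint half_poch (k : nat) : R :=
  match k with O => 1 | S k' => half_poch k' * (INR k' + 1 / 2) end.

(** Equals binom(2k, k) / 4^k; its cube majorizes the terms of both series. *)
Definition alpha (k : nat) : R := half_poch k / INR (fact k).

(* Obtained by expanding (1 - x y)^(- n - 1/2) in Beukers' integral with exponent n - 1/2. *)
Definition tI (n k : nat) : R :=
  half_poch (n + k) ^ 3 * half_poch n / (INR (fact k) * INR (fact (2 * n + k)) ^ 2).

(** Obtained by expanding (1 - x y)^(-l - 1/2) in the companion integral: the integrals in x and in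
    y are both B(k + 1/2, l + 1/2), and each contributes one factor pi. *)
Definition tX (l k : nat) : R :=
  half_poch (l + k) * half_poch l * half_poch k ^ 2 / (INR (fact k) * INR (fact (k + l)) ^ 2).

Definition sI (n : nat) : R := Series (tI n).
Definition sX (l : nat) : R := Series (tX l).

Lemma half_poch_pos k : 0 < half_poch k.
Proof.
  induction k as [|k IH]; simpl; [lra|].
  apply Rmult_lt_0_compat; [exact IH|]. pose proof (pos_INR k). lra.
Qed.

Lemma alpha_pos k : 0 < alpha k.
Proof. apply Rdiv_lt_0_compat; [apply half_poch_pos | apply INR_fact_lt_0]. Qed.

Lemma alpha_0 : alpha 0 = 1.
Proof. unfold alpha; simpl. field. Qed.

Lemma alpha_S k : alpha (S k) = alpha k * ((INR k + 1 / 2) / (INR k + 1)).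
Proof.
  unfold alpha. rewrite fact_simpl, mult_INR, S_INR. simpl half_poch.
  pose proof (pos_INR k). pose proof (INR_fact_neq_0 k). field. lra.
Qed.

(** The induction step is (2k+1)(2k+3) <= (2k+2)^2. The resulting decay kills the boundary terms of
    the certificates. *)
Lemma alpha_sq_le k : alpha k ^ 2 <= 1 / (2 * INR k + 1).
Proof.
  induction k as [|k IH].
  - rewrite alpha_0; simpl. apply Req_le. field.
  - rewrite alpha_S, S_INR. pose proof (pos_INR k) as Hk.
    set (x := INR k) in *.
    rewrite Rpow_mult_distr.
    apply Rle_trans with (1 / (2 * x + 1) * ((x + 1 / 2) / (x + 1)) ^ 2).
    + apply Rmult_le_compat_r; [apply pow2_ge_0 | exact IH].
    + replace (1 / (2 * x + 1) * ((x + 1 / 2) / (x + 1)) ^ 2)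
        with ((2 * x + 1) / (2 * x + 2) ^ 2) by (field; lra).
      apply le_div_r; [lra|].
      replace ((2 * x + 1) / (2 * x + 2) ^ 2 * (2 * (x + 1) + 1))
        with ((2 * x + 1) * (2 * x + 3) / (2 * x + 2) ^ 2) by (field; lra).
      apply div_le_l; nra.
Qed.

Lemma alpha_lim : is_lim_seq alpha 0.
Proof.
  apply is_lim_seq_le_le with (u := fun _ => 0) (w := fun k => sqrt (/ (2 * INR k + 1))).
  - intros k. split; [apply Rlt_le, alpha_pos|].
    rewrite <- (sqrt_pow2 (alpha k)) by apply Rlt_le, alpha_pos.
    apply sqrt_le_1_alt. rewrite <- (Rmult_1_l (/ _)). apply alpha_sq_le.
  - apply is_lim_seq_const.
  - rewrite <- sqrt_0.
    apply (is_lim_seq_continuous sqrt (fun k => / (2 * INR k + 1)) 0).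
    + apply continuity_pt_sqrt. lra.
    + replace (Finite 0) with (Rbar_inv p_infty) by reflexivity.
      apply is_lim_seq_inv; [|discriminate].
      apply is_lim_seq_le_p_loc with (u := INR).
      * exists O. intros n _. pose proof (pos_INR n). lra.
      * apply is_lim_seq_INR.
Qed.

Lemma tI_pos n k : 0 < tI n k.
Proof.
  unfold tI. apply Rdiv_lt_0_compat.
  - apply Rmult_lt_0_compat; [apply pow_lt|]; apply half_poch_pos.
  - apply Rmult_lt_0_compat; [|apply pow_lt]; apply INR_fact_lt_0.
Qed.

Lemma tX_pos l k : 0 < tX l k.
Proof.
  unfold tX. apply Rdiv_lt_0_compat.
  - repeat apply Rmult_lt_0_compat; try apply pow_lt; try apply half_poch_pos; lra.
  - apply Rmult_lt_0_compat; [|apply pow_lt]; apply INR_fact_lt_0.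
Qed.

Lemma tI_Sn n k : tI (S n) k = tI n k *
  ((INR n + INR k + 1 / 2) ^ 3 * (INR n + 1 / 2)
   / ((2 * INR n + INR k + 1) ^ 2 * (2 * INR n + INR k + 2) ^ 2)).
Proof.
  unfold tI.
  replace (S n + k)%nat with (S (n + k)) by lia.
  replace (2 * S n + k)%nat with (S (S (2 * n + k))) by lia.
  rewrite !fact_simpl, !mult_INR, !S_INR, !plus_INR, mult_INR. simpl half_poch.
  rewrite !plus_INR. change (INR 2) with 2.
  pose proof (pos_INR k). pose proof (pos_INR n).
  pose proof (INR_fact_neq_0 k). pose proof (INR_fact_neq_0 (2 * n + k)).
  simpl (2 * n)%nat in *.
  field. repeat split; try assumption; lra.
Qed.

Lemma tI_Sk n k : tI n (S k) = tI n k *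
  ((INR n + INR k + 1 / 2) ^ 3 / ((INR k + 1) * (2 * INR n + INR k + 1) ^ 2)).
Proof.
  unfold tI.
  replace (n + S k)%nat with (S (n + k)) by lia.
  replace (2 * n + S k)%nat with (S (2 * n + k)) by lia.
  rewrite !fact_simpl, !mult_INR, !S_INR, !plus_INR, mult_INR. simpl half_poch.
  rewrite !plus_INR. change (INR 2) with 2.
  pose proof (pos_INR k). pose proof (pos_INR n).
  pose proof (INR_fact_neq_0 k). pose proof (INR_fact_neq_0 (2 * n + k)).
  simpl (2 * n)%nat in *.
  field. repeat split; try assumption; lra.
Qed.

Lemma tX_Sl l k : tX (S l) k = tX l k *
  ((INR l + INR k + 1 / 2) * (INR l + 1 / 2) / (INR l + INR k + 1) ^ 2).
Proof.
  unfold tX.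
  replace (S l + k)%nat with (S (l + k)) by lia.
  replace (k + S l)%nat with (S (k + l)) by lia.
  rewrite !fact_simpl, !mult_INR, !S_INR, !plus_INR. simpl half_poch.
  rewrite !plus_INR.
  pose proof (pos_INR k). pose proof (pos_INR l).
  pose proof (INR_fact_neq_0 k). pose proof (INR_fact_neq_0 (k + l)).
  field. repeat split; try assumption; lra.
Qed.

Lemma tX_Sk l k : tX l (S k) = tX l k *
  ((INR l + INR k + 1 / 2) * (INR k + 1 / 2) ^ 2
   / ((INR k + 1) * (INR l + INR k + 1) ^ 2)).
Proof.
  unfold tX.
  replace (l + S k)%nat with (S (l + k)) by lia.
  replace (S k + l)%nat with (S (k + l)) by lia.
  rewrite !fact_simpl, !mult_INR, !S_INR, !plus_INR. simpl half_poch.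
  rewrite !plus_INR.
  pose proof (pos_INR k). pose proof (pos_INR l).
  pose proof (INR_fact_neq_0 k). pose proof (INR_fact_neq_0 (k + l)).
  field. repeat split; try assumption; lra.
Qed.

Lemma tX_0 k : tX 0 k = alpha k ^ 3.
Proof.
  unfold tX, alpha. rewrite Nat.add_0_r. simpl (0 + k)%nat. simpl (half_poch 0).
  pose proof (INR_fact_neq_0 k). field. assumption.
Qed.

Lemma tI_0 k : tI 0 k = alpha k ^ 3.
Proof.
  unfold tI, alpha. simpl (2 * 0 + k)%nat. simpl (0 + k)%nat. simpl (half_poch 0).
  pose proof (INR_fact_neq_0 k). field. assumption.
Qed.

(** Raising [n] by one multiplies the term by at most 1, so the terms at [n = 0] majorize all the
    others. *)
Lemma tI_le n k : tI n k <= alpha k ^ 3.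
Proof.
  induction n as [|n IH]; [rewrite tI_0; lra|].
  refine (Rle_trans _ _ _ _ IH). rewrite tI_Sn.
  rewrite <- (Rmult_1_r (tI n k)) at 2.
  apply Rmult_le_compat_l; [apply Rlt_le, tI_pos|].
  pose proof (pos_INR k). pose proof (pos_INR n).
  set (N := INR n) in *. set (K := INR k) in *.
  assert (0 <= N * K) by nra.
  apply div_le_l.
  - apply Rmult_lt_0_compat; apply pow_lt; lra.
  - rewrite Rmult_1_l.
    replace ((N + K + 1 / 2) ^ 3 * (N + 1 / 2))
      with ((N + K + 1 / 2) ^ 2 * ((N + K + 1 / 2) * (N + 1 / 2))) by ring.
    apply Rmult_le_compat; [apply pow2_ge_0 | nra | apply pow_incr; lra |].
    nra.
Qed.

Lemma tX_le l k : tX l k <= alpha k ^ 3.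
Proof.
  induction l as [|l IH]; [rewrite tX_0; lra|].
  refine (Rle_trans _ _ _ _ IH). rewrite tX_Sl.
  rewrite <- (Rmult_1_r (tX l k)) at 2.
  apply Rmult_le_compat_l; [apply Rlt_le, tX_pos|].
  pose proof (pos_INR k). pose proof (pos_INR l).
  apply div_le_l; [apply pow_lt; lra|]. nra.
Qed.


Lemma alpha3_summable : ex_series (fun k => alpha k ^ 3).
Proof.
  (* The quantity 8 k alpha_k^3 drops by at least alpha_k^3 at each step k >= 1, because 8 (k +
     1/2)^3 <= (8k - 1)(k + 1)^2 there. The constant 2 makes the case [n = 0] an equality. *)
  assert (Hs : forall n, sum_n (fun k => alpha k ^ 3) n
     <= 2 - 8 * INR (S n) * alpha (S n) ^ 3).
  { induction n as [|n IH].
    - rewrite sum_O, alpha_S, alpha_0. simpl. lra.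
    - rewrite sum_Sn. change plus with Rplus.
      rewrite (alpha_S (S n)). pose proof (alpha_pos (S n)) as Ha.
      rewrite (S_INR (S n)).
      assert (Hn : 1 <= INR (S n)) by (rewrite S_INR; pose proof (pos_INR n); lra).
      set (x := INR (S n)) in *. set (a := alpha (S n)) in *.
      apply Rle_trans with (2 - 8 * x * a ^ 3 + a ^ 3); [lra|].
      rewrite Rpow_mult_distr.
      assert (Ha3 : 0 < a ^ 3) by (apply pow_lt; exact Ha).
      assert (8 * (x + 1) * ((x + 1 / 2) / (x + 1)) ^ 3 <= 8 * x - 1).
      { replace (8 * (x + 1) * ((x + 1 / 2) / (x + 1)) ^ 3)
          with (8 * (x + 1 / 2) ^ 3 / (x + 1) ^ 2) by (field; lra).
        apply div_le_l; nra. }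
      nra. }
  destruct (ex_finite_lim_seq_incr (sum_n (fun k => alpha k ^ 3)) 2) as [l Hl].
  - intros n. rewrite sum_Sn. change plus with Rplus.
    pose proof (pow_lt _ 3 (alpha_pos (S n))). lra.
  - intros n. refine (Rle_trans _ _ _ (Hs n) _).
    pose proof (pow_lt _ 3 (alpha_pos (S n))). pose proof (pos_INR (S n)). nra.
  - exists l. exact Hl.
Qed.

Lemma tI_summable n : ex_series (tI n).
Proof.
  apply (@ex_series_le R_AbsRing R_CompleteNormedModule) with (fun k => alpha k ^ 3);
    [|exact alpha3_summable].
  intros k. change (Rabs (tI n k) <= alpha k ^ 3).
  rewrite Rabs_pos_eq; [apply tI_le | apply Rlt_le, tI_pos].
Qed.

Lemma tX_summable l : ex_series (tX l).
Proof.
  apply (@ex_series_le R_AbsRing R_CompleteNormedModule) with (fun k => alpha k ^ 3);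
    [|exact alpha3_summable].
  intros k. change (Rabs (tX l k) <= alpha k ^ 3).
  rewrite Rabs_pos_eq; [apply tX_le | apply Rlt_le, tX_pos].
Qed.

Lemma Series_term_le (a : nat -> R) (k : nat) :
  (forall i, 0 <= a i) -> ex_series a -> a k <= Series a.
Proof.
  intros Ha He.
  assert (Hd : forall n, sum_n a n <= Series a).
  { apply is_lim_seq_incr_compare.
    - exact (Series_correct a He).
    - intros n. rewrite sum_Sn. change plus with Rplus. specialize (Ha (S n)). lra. }
  refine (Rle_trans _ _ _ _ (Hd k)).
  destruct k as [|k]; [rewrite sum_O; lra|].
  rewrite sum_Sn. change plus with Rplus.
  assert (0 <= sum_n a k); [|lra].
  rewrite sum_n_Reals. apply cond_pos_sum, Ha.
Qed.

Lemma sI_pos n : 0 < sI n.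
Proof.
  apply Rlt_le_trans with (tI n 0); [apply tI_pos|].
  apply Series_term_le; [intros; apply Rlt_le, tI_pos | apply tI_summable].
Qed.

Lemma ex_series_mult_l (c : R) (a : nat -> R) :
  ex_series a -> ex_series (fun k => c * a k).
Proof. exact (@ex_series_scal R_AbsRing R_NormedModule c a). Qed.

(** The final step of creative telescoping. A factor [k] in each certificate makes [G 0] vanish. *)
Lemma is_series_telescope (e G : nat -> R) :
  (forall k, e k = G (S k) - G k) -> G O = 0 -> is_lim_seq G 0 -> is_series e 0.
Proof.
  intros He H0 HG.
  change (is_lim_seq (sum_n e) 0).
  apply is_lim_seq_ext with (fun n => G (S n)).
  - intros n. induction n as [|n IH].
    + rewrite sum_O, He, H0. lra.
    + rewrite sum_Sn, <- IH, He. change plus with Rplus. lra.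
  - apply (is_lim_seq_incr_1 G). exact HG.
Qed.

(** Since k alpha_k^2 <= 1, the assumed bound is at most a multiple of [alpha k]. *)
Lemma telescope_bound_lim (G : nat -> R) (C : R) :
  (forall k, Rabs (G k) <= C * (INR k * alpha k ^ 3)) -> is_lim_seq G 0.
Proof.
  intros HG. apply is_lim_seq_abs_0.
  apply is_lim_seq_le_le with (fun _ => 0) (fun k => Rabs C * alpha k).
  - intros k. split; [apply Rabs_pos|].
    refine (Rle_trans _ _ _ (HG k) _).
    pose proof (pos_INR k). pose proof (alpha_pos k). pose proof (alpha_sq_le k) as Hs.
    apply Rle_trans with (Rabs C * (INR k * alpha k ^ 3)).
    + apply Rmult_le_compat_r; [|apply Rle_abs].
      apply Rmult_le_pos; [assumption|apply pow_le; lra].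
    + apply Rmult_le_compat_l; [apply Rabs_pos|].
      apply (proj2 (Rle_div_r (alpha k ^ 2) 1 (2 * INR k + 1) ltac:(lra))) in Hs.
      assert (INR k * alpha k ^ 2 <= 1) by (pose proof (pow2_ge_0 (alpha k)); nra).
      nra.
  - apply is_lim_seq_const.
  - replace (Finite 0) with (Rbar_mult (Rabs C) 0) by (simpl; f_equal; ring).
    apply is_lim_seq_scal_l. exact alpha_lim.
Qed.

(** Degree 6 is both the degree of [certI] in [K] and that of the denominator of its certificate, so
    their quotient stays bounded. *)
Lemma poly6_bound (c0 c1 c2 c3 c4 c5 c6 x : R) : 0 <= x ->
  Rabs (c0 + c1 * x + c2 * x ^ 2 + c3 * x ^ 3 + c4 * x ^ 4 + c5 * x ^ 5 + c6 * x ^ 6)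
  <= (Rabs c0 + Rabs c1 + Rabs c2 + Rabs c3 + Rabs c4 + Rabs c5 + Rabs c6) * (x + 1) ^ 6.
Proof.
  intros Hx.
  assert (H : forall c i, (i <= 6)%nat -> Rabs (c * x ^ i) <= Rabs c * (x + 1) ^ 6).
  { intros c i Hi. rewrite Rabs_mult. apply Rmult_le_compat_l; [apply Rabs_pos|].
    rewrite Rabs_pos_eq by (apply pow_le; lra).
    apply Rle_trans with ((x + 1) ^ i); [apply pow_incr; lra|].
    apply Rle_pow; [lra|exact Hi]. }
  pose proof (H c0 0%nat ltac:(lia)). pose proof (H c1 1%nat ltac:(lia)).
  pose proof (H c2 2%nat ltac:(lia)). pose proof (H c3 3%nat ltac:(lia)).
  pose proof (H c4 4%nat ltac:(lia)). pose proof (H c5 5%nat ltac:(lia)).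
  pose proof (H c6 6%nat ltac:(lia)).
  rewrite pow_O, Rmult_1_r in H0. rewrite pow_1 in H1.
  rewrite !Rmult_plus_distr_r.
  do 6 (refine (Rle_trans _ _ _ (Rabs_triang _ _) _); apply Rplus_le_compat; [|assumption]).
  assumption.
Qed.

(* [k * tI n k * certI n k / ((2n+k+1) (2n+k+2) (2n+k+3))^2] is the Zeilberger certificate of the
   recurrence [sI_rec]. *)
Definition certI (N K : R) : R :=
  (-(3645/32) - 16569/16*N - 31089/8*N^2 - 31133/4*N^3 - 17959/2*N^4 - 5979*N^5
     - 2134*N^6 - 316*N^7)
  + (-(6795/16) - 6309/2*N - 37507/4*N^2 - 14284*N^3 - 11801*N^4 - 5032*N^5 - 868*N^6) * K
  + (-(4317/8) - 12793/4*N - 7299*N^2 - 8054*N^3 - 4314*N^4 - 900*N^5) * K ^ 2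
  + (-(503/2) - 1208*N - 2068*N^2 - 1520*N^3 - 408*N^4) * K ^ 3
  + (-(55/2) - 107*N - 130*N^2 - 52*N^3) * K ^ 4
  + (10 + 28*N + 16*N^2) * K ^ 5 + (2 + 4*N) * K ^ 6.

Lemma sI_rec n :
  (2 * INR n + 3) ^ 2 * sI (S (S n)) + (44 * (INR n + 1) ^ 2 + 1) * sI (S n)
  = (2 * INR n + 1) ^ 2 * sI n.
Proof.
  pose proof (pos_INR n) as Hn. set (N := INR n) in *.
  set (e := fun k => (2 * N + 3) ^ 2 * tI (S (S n)) k + (44 * (N + 1) ^ 2 + 1) * tI (S n) k
            - (2 * N + 1) ^ 2 * tI n k).
  set (G := fun k => INR k * tI n k * certI N (INR k)
      / ((2 * N + INR k + 1) * (2 * N + INR k + 2) * (2 * N + INR k + 3)) ^ 2).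
  assert (He : is_series e 0).
  { apply is_series_telescope with G.
    - intros k. unfold e, G. rewrite (tI_Sn (S n)), !tI_Sn, tI_Sk, !S_INR.
      fold N. pose proof (pos_INR k). generalize (tI n k); intros t.
      generalize dependent (INR k). intros K HK. unfold certI. field. lra.
    - unfold G. simpl. unfold Rdiv. ring.
    (* The coefficients of [certI N] in [K] are read off its unfolded body; the argument 0 is a mere
       placeholder for the syntactic match. *)
    - match eval unfold certI in (certI N 0) with
      | ?c0 + ?c1 * _ + ?c2 * _ + ?c3 * _ + ?c4 * _ + ?c5 * _ + ?c6 * _ =>
        apply telescope_bound_lim with
          (Rabs c0 + Rabs c1 + Rabs c2 + Rabs c3 + Rabs c4 + Rabs c5 + Rabs c6);
        intros k; pose proof (poly6_bound c0 c1 c2 c3 c4 c5 c6 (INR k) (pos_INR k)) as Hb;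
        change (Rabs (certI N (INR k)) <=
          (Rabs c0 + Rabs c1 + Rabs c2 + Rabs c3 + Rabs c4 + Rabs c5 + Rabs c6) *
          (INR k + 1) ^ 6) in Hb;
        set (C := Rabs c0 + Rabs c1 + Rabs c2 + Rabs c3 + Rabs c4 + Rabs c5 + Rabs c6) in *
      end.
      pose proof (pos_INR k) as Hk. pose proof (tI_pos n k) as Ht. pose proof (tI_le n k) as Hl.
      unfold G. set (K := INR k) in *. clearbody C.
      set (D := (2 * N + K + 1) * (2 * N + K + 2) * (2 * N + K + 3)).
      assert (HD : (K + 1) ^ 3 <= D).
      { unfold D. simpl. rewrite Rmult_1_r, <- Rmult_assoc.
        repeat apply Rmult_le_compat; try nra. }
      assert (HK3 : 0 < (K + 1) ^ 3) by (apply pow_lt; lra).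
      assert (HD2 : (K + 1) ^ 6 <= D ^ 2).
      { replace ((K + 1) ^ 6) with (((K + 1) ^ 3) ^ 2) by ring. apply pow_incr. lra. }
      assert (HK6 : 0 < (K + 1) ^ 6) by (apply pow_lt; lra).
      unfold Rdiv. rewrite !Rabs_mult, Rabs_inv.
      rewrite (Rabs_pos_eq K Hk), (Rabs_pos_eq (tI n k)) by lra.
      rewrite (Rabs_pos_eq (D ^ 2)) by lra.
      apply div_le_l; [lra|].
      assert (HC : 0 <= C) by (pose proof (Rabs_pos (certI N K)); nra).
      apply Rle_trans with (K * tI n k * (C * D ^ 2)).
      + apply Rmult_le_compat_l; [nra|].
        refine (Rle_trans _ _ _ Hb _). apply Rmult_le_compat_l; lra.
      + replace (C * (K * alpha k ^ 3) * D ^ 2) with (K * alpha k ^ 3 * (C * D ^ 2)) by ring.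
        apply Rmult_le_compat_r; [nra|]. apply Rmult_le_compat_l; lra. }
  apply is_series_unique in He. unfold e in He.
  rewrite Series_minus, Series_plus, !Series_scal_l in He.
  - unfold sI. lra.
  - apply ex_series_mult_l, tI_summable.
  - apply ex_series_mult_l, tI_summable.
  - apply (@ex_series_plus R_AbsRing R_NormedModule); apply ex_series_mult_l, tI_summable.
  - apply ex_series_mult_l, tI_summable.
Qed.

Lemma sX_rec l :
  (2 * INR l + 3) ^ 2 * sX (S (S l)) = (2 * INR l + 1) ^ 2 * sX l.
Proof.
  pose proof (pos_INR l) as Hl. set (L := INR l) in *.
  set (e := fun k => (2 * L + 3) ^ 2 * tX (S (S l)) k - (2 * L + 1) ^ 2 * tX l k).
  (* Coefficients in [k] of the numerator of the Zeilberger certificate [G]. They are positive, so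
     [G] is nonnegative and easy to bound. *)
  set (c0 := 3/2 + 9*L + 16*L^2 + 8*L^3).
  set (c1 := 5 + 16*L + 12*L^2).
  set (c2 := 2 + 4*L).
  set (G := fun k => INR k * tX l k * (c0 + c1 * INR k + c2 * INR k ^ 2)
      / (L + INR k + 1) ^ 2).
  assert (Hc0 : 0 < c0) by (unfold c0; nra).
  assert (Hc1 : 0 < c1) by (unfold c1; nra).
  assert (Hc2 : 0 < c2) by (unfold c2; nra).
  assert (He : is_series e 0).
  { apply is_series_telescope with G.
    - intros k. unfold e, G. rewrite (tX_Sl (S l)), !tX_Sl, tX_Sk, !S_INR.
      fold L. pose proof (pos_INR k). generalize (tX l k); intros t.
      generalize dependent (INR k). intros K HK. unfold c0, c1, c2. field. lra.
    - unfold G. simpl. unfold Rdiv. ring.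
    - apply telescope_bound_lim with (c0 + c1 + c2). intros k.
      pose proof (pos_INR k) as Hk. pose proof (tX_pos l k) as Ht. pose proof (tX_le l k) as Hle.
      unfold G. set (K := INR k) in *. clearbody c0 c1 c2.
      assert (HD : (K + 1) ^ 2 <= (L + K + 1) ^ 2) by (apply pow_incr; lra).
      assert (HK : 0 < (K + 1) ^ 2) by (apply pow_lt; lra).
      assert (Hp : 0 <= c0 + c1 * K + c2 * K ^ 2) by nra.
      rewrite Rabs_pos_eq.
      2: { apply Rdiv_le_0_compat; [|lra]. apply Rmult_le_pos; [|exact Hp].
           apply Rmult_le_pos; lra. }
      apply div_le_l; [lra|].
      apply Rle_trans with (K * tX l k * ((c0 + c1 + c2) * (L + K + 1) ^ 2)).
      + apply Rmult_le_compat_l; [nra|].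
        apply Rle_trans with ((c0 + c1 + c2) * (K + 1) ^ 2); [nra|].
        apply Rmult_le_compat_l; lra.
      + replace ((c0 + c1 + c2) * (K * alpha k ^ 3) * (L + K + 1) ^ 2)
          with (K * alpha k ^ 3 * ((c0 + c1 + c2) * (L + K + 1) ^ 2)) by ring.
        apply Rmult_le_compat_r; [nra|]. apply Rmult_le_compat_l; lra. }
  apply is_series_unique in He. unfold e in He.
  rewrite Series_minus, !Series_scal_l in He.
  - unfold sX. lra.
  - apply ex_series_mult_l, tX_summable.
  - apply ex_series_mult_l, tX_summable.
Qed.

Lemma sI_sX_0 : sI 0 = sX 0.
Proof. apply Series_ext. intros k. rewrite tI_0, tX_0. reflexivity. Qed.

(** The bridge between the two families at index 1, again by a rational certificate: with [sI_sX_0]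
    it expresses both initial values of [sI] through the companion series. *)
Lemma sI_sX_1 : 2 * sI 1 + sI 0 = 5 * sX 1.
Proof.
  set (e := fun k => 2 * tI 1 k + tI 0 k - 5 * tX 1 k).
  set (G := fun k => INR k * tI 0 k * (-1 - 4 * INR k - 2 * INR k ^ 2) / (INR k + 1) ^ 2).
  assert (He : is_series e 0).
  { apply is_series_telescope with G.
    - intros k. unfold e, G. rewrite tI_Sn, tX_Sl, tI_Sk, S_INR, tX_0, tI_0.
      simpl (INR 0). pose proof (pos_INR k). generalize (alpha k ^ 3); intros t.
      generalize dependent (INR k). intros K HK. field. lra.
    - unfold G. simpl. unfold Rdiv. ring.
    (* 7 = 1 + 4 + 2, the sum of the absolute values of the coefficients in the certificate. *)
    - apply telescope_bound_lim with 7. intros k. unfold G. rewrite tI_0.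
      pose proof (pos_INR k) as Hk. pose proof (pow_lt _ 3 (alpha_pos k)) as Ht.
      set (K := INR k) in *.
      assert (HK : 0 < (K + 1) ^ 2) by (apply pow_lt; lra).
      rewrite Rabs_left1.
      2: { replace (K * alpha k ^ 3 * (-1 - 4 * K - 2 * K ^ 2) / (K + 1) ^ 2)
             with (- (K * alpha k ^ 3 * (1 + 4 * K + 2 * K ^ 2) / (K + 1) ^ 2)) by (field; lra).
           apply Ropp_le_cancel. rewrite Ropp_0, Ropp_involutive.
           apply Rdiv_le_0_compat; [|lra]. apply Rmult_le_pos; nra. }
      replace (- (K * alpha k ^ 3 * (-1 - 4 * K - 2 * K ^ 2) / (K + 1) ^ 2))
             with (K * alpha k ^ 3 * (1 + 4 * K + 2 * K ^ 2) / (K + 1) ^ 2) by (field; lra).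
      apply div_le_l; [lra|].
      replace (7 * (K * alpha k ^ 3) * (K + 1) ^ 2)
        with (K * alpha k ^ 3 * (7 * (K + 1) ^ 2)) by ring.
      apply Rmult_le_compat_l; nra. }
  apply is_series_unique in He. unfold e in He.
  rewrite Series_minus, Series_plus, !Series_scal_l in He.
  - unfold sI, sX. lra.
  - apply ex_series_mult_l, tI_summable.
  - apply tI_summable.
  - apply (@ex_series_plus R_AbsRing R_NormedModule);
      [apply ex_series_mult_l|]; apply tI_summable.
  - apply ex_series_mult_l, tX_summable.
Qed.

(** * The Gamma function *)

(** Close to the two limits both endpoints are positive, so properties on (0, infinity) hold along
    the whole interval of integration. *)
Lemma filter_prod_pos_interval (P : R -> Prop) : (forall t, 0 < t -> P t) ->
  filter_prod (at_right 0) (Rbar_locally p_infty)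
    (fun ab => forall t, Rmin (fst ab) (snd ab) <= t <= Rmax (fst ab) (snd ab) -> P t).
Proof.
  intros HP. apply Filter_prod with (fun a => 0 < a) (fun b => 0 < b).
  - exists (mkposreal 1 Rlt_0_1). intros y _ Hy. exact Hy.
  - exists 0. intros y Hy. exact Hy.
  - intros a b Ha Hb t [Ht _]. apply HP. simpl in Ht.
    apply Rlt_le_trans with (2 := Ht). apply Rmin_pos; assumption.
Qed.

Lemma ex_RInt_pos_interval (f : R -> R) (x y : R) :
  (forall t, 0 < t -> continuous f t) -> 0 < x -> 0 < y -> ex_RInt f x y.
Proof.
  intros Hf Hx Hy. apply (@ex_RInt_continuous R_CompleteNormedModule).
  intros z [Hz _]. apply Hf. apply Rlt_le_trans with (2 := Hz). apply Rmin_pos; assumption.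
Qed.

(** For a nonnegative integrand the integral grows with the interval, so the supremum over all
    intervals is the improper integral. *)
Lemma is_RInt_gen_nonneg_bounded (f : R -> R) (M : R) :
  (forall t, 0 < t -> 0 <= f t) -> (forall t, 0 < t -> continuous f t) ->
  (forall x y, 0 < x <= y -> RInt f x y <= M) ->
  exists l, is_RInt_gen f (at_right 0) (Rbar_locally p_infty) l /\
    forall x y, 0 < x <= y -> RInt f x y <= l.
Proof.
  intros Hpos Hcont Hbnd.
  set (E := fun r => exists x y, 0 < x <= y /\ r = RInt f x y).
  destruct (completeness E) as [l [Hub Hlub]].
  - exists M. intros r [x [y [Hxy ->]]]. apply Hbnd, Hxy.
  - exists (RInt f 1 1), 1, 1. split; [lra|reflexivity].
  - exists l.
    assert (Hle : forall x y, 0 < x <= y -> RInt f x y <= l).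
    { intros x y Hxy. apply Hub. exists x, y. split; [exact Hxy|reflexivity]. }
    split; [|exact Hle].
    intros P [eps HP].
    assert (Hex : exists x0 y0, 0 < x0 <= y0 /\ l - eps < RInt f x0 y0).
    { destruct (Classical_Prop.classic (exists x0 y0, 0 < x0 <= y0 /\ l - eps < RInt f x0 y0))
        as [H|H]; [exact H|exfalso].
      assert (l <= l - eps).
      { apply Hlub. intros r [x [y [Hxy ->]]].
        destruct (Rle_lt_dec (RInt f x y) (l - eps)) as [H1|H1]; [exact H1|].
        exfalso. apply H. exists x, y. split; assumption. }
      pose proof (cond_pos eps). lra. }
    destruct Hex as [x0 [y0 [[Hx0 Hxy0] Hr]]].
    apply Filter_prod with (fun a => 0 < a < x0) (fun b => y0 < b).
    + exists (mkposreal x0 Hx0). intros y Hy Hy0. split; [exact Hy0|].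
      unfold ball in Hy; simpl in Hy; unfold AbsRing_ball, abs, minus, plus, opp in Hy; simpl in Hy.
      apply Rabs_def2 in Hy. lra.
    + exists y0. intros y Hy. exact Hy.
    + intros a b [Ha Hax] Hb. exists (RInt f a b). simpl.
      assert (Hi : forall x y, 0 < x -> 0 < y -> ex_RInt f x y)
        by (intros; apply ex_RInt_pos_interval; assumption).
      split; [apply (RInt_correct f), Hi; lra|].
      apply HP.
      assert (H1 : RInt f a b = RInt f a x0 + RInt f x0 y0 + RInt f y0 b).
      { rewrite <- (RInt_Chasles f a y0 b), <- (RInt_Chasles f a x0 y0) by (apply Hi; lra).
        reflexivity. }
      assert (H2 : 0 <= RInt f a x0)
        by (apply RInt_ge_0; [lra|apply Hi; lra|intros; apply Hpos; lra]).
      assert (H3 : 0 <= RInt f y0 b)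
        by (apply RInt_ge_0; [lra|apply Hi; lra|intros; apply Hpos; lra]).
      pose proof (Hle a b ltac:(lra)).
      unfold ball; simpl; unfold AbsRing_ball, abs, minus, plus, opp; simpl.
      apply Rabs_def1; pose proof (cond_pos eps); lra.
Qed.

Definition gamma_integrand (s t : R) : R := Rpower t (s - 1) * exp (- t).

(** The boundary term in the integration by parts behind the functional equation. *)
Definition gamma_primitive (s t : R) : R := Rpower t s * exp (- t).

Lemma gamma_integrand_pos s t : 0 < gamma_integrand s t.
Proof. apply Rmult_lt_0_compat; apply exp_pos. Qed.

Lemma gamma_integrand_cont s t : 0 < t -> continuous (gamma_integrand s) t.
Proof.
  intros Ht. apply (@ex_derive_continuous R_AbsRing R_NormedModule).
  unfold gamma_integrand, Rpower. auto_derive. exact Ht.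
Qed.

Lemma gamma_integrand_succ s t : 0 < t -> gamma_integrand (s + 1) t = t * gamma_integrand s t.
Proof.
  intros Ht. unfold gamma_integrand. replace (s + 1 - 1) with (1 + (s - 1)) by ring.
  rewrite Rpower_plus, Rpower_1 by exact Ht. ring.
Qed.

Lemma gamma_integrand_half s t :
  0 < t -> gamma_integrand (s + 1 / 2) t = sqrt t * gamma_integrand s t.
Proof.
  intros Ht. unfold gamma_integrand. replace (s + 1 / 2 - 1) with (/ 2 + (s - 1)) by field.
  rewrite Rpower_plus, Rpower_sqrt by exact Ht. ring.
Qed.

Lemma gamma_primitive_derive s t : 0 < t ->
  is_derive (gamma_primitive s) t (s * gamma_integrand s t - gamma_integrand (s + 1) t).
Proof.
  intros Ht. rewrite gamma_integrand_succ by exact Ht.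
  unfold gamma_primitive, gamma_integrand. unfold Rpower at 1. auto_derive; [exact Ht|].
  replace (exp (s * ln t)) with (t * Rpower t (s - 1)).
  - generalize (exp (- t)) (Rpower t (s - 1)). intros u v. field. lra.
  - rewrite <- (Rpower_1 t) at 1 by exact Ht. rewrite <- Rpower_plus.
    replace (1 + (s - 1)) with s by ring. reflexivity.
Qed.

(* [exp (s ln (2 s) - s)] is the maximum of [t^s exp (- t / 2)], attained at [t = 2 s]. *)
Lemma gamma_primitive_le s t : 0 < s -> 0 < t ->
  gamma_primitive s t <= exp (s * ln (2 * s) - s) * exp (- t / 2).
Proof.
  intros Hs Ht. unfold gamma_primitive, Rpower. rewrite <- !exp_plus.
  assert (Hl : ln t <= ln (2 * s) + (t / (2 * s) - 1)).
  { assert (H : ln (t / (2 * s)) <= t / (2 * s) - 1).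
    { pose proof (exp_ineq1_le (ln (t / (2 * s)))) as H.
      rewrite exp_ln in H by (apply Rdiv_lt_0_compat; lra). lra. }
    rewrite ln_div in H by lra. lra. }
  assert (H : s * ln t <= s * ln (2 * s) - s + t / 2).
  { replace (s * ln (2 * s) - s + t / 2) with (s * (ln (2 * s) + (t / (2 * s) - 1))) by (field; lra).
    apply Rmult_le_compat_l; lra. }
  destruct (Rle_lt_or_eq_dec (s * ln t + - t) (s * ln (2 * s) - s + - t / 2)) as [H'|H'];
    [lra | apply Rlt_le, exp_increasing, H' | rewrite H'; lra].
Qed.

Lemma gamma_integral_bound s : 0 < s ->
  exists M, forall x y, 0 < x <= y -> RInt (gamma_integrand s) x y <= M.
Proof.
  intros Hs. set (B := exp (s * ln (2 * s) - s)).
  assert (HB : 0 < B) by apply exp_pos.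
  (* [H'] is at least twice the integrand: differentiating (2/s) t^s e^(-t) gives twice the
     integrand minus (2/s) t^s e^(-t), and the added exponential compensates the loss by
     [gamma_primitive_le]. The explicit primitive [H] then handles both ends at once. *)
  set (H := fun t => 2 / s * gamma_primitive s t - 4 / s * B * exp (- t / 2)).
  set (H' := fun t => 2 / s * (s * gamma_integrand s t - gamma_integrand (s + 1) t)
                      + 2 / s * B * exp (- t / 2)).
  assert (Hs' : 0 < / s) by (apply Rinv_0_lt_compat, Hs).
  exists (2 / s * B + 4 / s * B). intros x y Hxy.
  assert (Hint : is_RInt H' x y (H y - H x)).
  { apply (is_RInt_derive H H').
    - intros t Ht. rewrite Rmin_left, Rmax_right in Ht by lra.
      unfold H, H'. apply (is_derive_ext (fun t => 2 / s * gamma_primitive s t +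
         - (4 / s * B * exp (- t / 2)))); [intros; reflexivity|].
      apply (@is_derive_plus R_AbsRing R_NormedModule).
      + apply is_derive_scal, gamma_primitive_derive. lra.
      + auto_derive; [exact I|]. change (- t / 2) with (- t * / 2). field. lra.
    - intros t Ht. rewrite Rmin_left, Rmax_right in Ht by lra.
      apply (@continuous_plus R_UniformSpace R_AbsRing R_NormedModule).
      + apply (@continuous_scal_r R_UniformSpace R_AbsRing R_NormedModule).
        apply (@continuous_minus R_UniformSpace R_AbsRing R_NormedModule).
        * apply (@continuous_scal_r R_UniformSpace R_AbsRing R_NormedModule).
          apply gamma_integrand_cont. lra.
        * apply gamma_integrand_cont. lra.
      + apply (@ex_derive_continuous R_AbsRing R_NormedModule). auto_derive. exact I. }
  apply Rle_trans with (H y - H x).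
  - rewrite <- (is_RInt_unique _ _ _ _ Hint).
    apply RInt_le; [lra | | exists (H y - H x); exact Hint |].
    + apply ex_RInt_pos_interval; [apply gamma_integrand_cont|lra|lra].
    + intros t Ht. unfold H'. rewrite gamma_integrand_succ by lra.
      pose proof (gamma_integrand_pos s t) as Hg.
      pose proof (gamma_primitive_le s t Hs ltac:(lra)) as Hle. fold B in Hle.
      assert (Hpg : gamma_primitive s t = t * gamma_integrand s t).
      { rewrite <- gamma_integrand_succ by lra. unfold gamma_primitive, gamma_integrand.
        replace (s + 1 - 1) with s by ring. reflexivity. }
      rewrite Hpg in Hle.
      replace (2 / s * (s * gamma_integrand s t - t * gamma_integrand s t))
        with (2 * gamma_integrand s t - 2 / s * (t * gamma_integrand s t)) by (field; lra).
      assert (2 / s * (t * gamma_integrand s t) <= 2 / s * (B * exp (- t / 2))).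
      { apply Rmult_le_compat_l; [unfold Rdiv; lra|exact Hle]. }
      lra.
  - unfold H.
    assert (Hy : gamma_primitive s y <= B).
    { refine (Rle_trans _ _ _ (gamma_primitive_le s y Hs ltac:(lra)) _). fold B.
      rewrite <- (Rmult_1_r B) at 2. apply Rmult_le_compat_l; [lra|].
      rewrite <- exp_0. apply Rlt_le, exp_increasing. lra. }
    assert (Hx : exp (- x / 2) <= 1) by (rewrite <- exp_0; apply Rlt_le, exp_increasing; lra).
    pose proof (exp_pos (- y / 2)) as Hey.
    assert (Hpx : 0 < gamma_primitive s x) by (apply Rmult_lt_0_compat; apply exp_pos).
    set (u := gamma_primitive s y) in *. set (v := gamma_primitive s x) in *.
    assert (0 < B / s) by (apply Rdiv_lt_0_compat; assumption).
    replace (2 / s * B + 4 / s * B) with (2 / s * B + 4 * (B / s)) by (field; lra).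
    replace (4 / s * B) with (4 * (B / s)) by (field; lra).
    assert (2 / s * u <= 2 / s * B) by (apply Rmult_le_compat_l; unfold Rdiv; lra).
    assert (0 < 2 / s * v) by (apply Rmult_lt_0_compat; unfold Rdiv; lra).
    nra.
Qed.

(** [RInt_gen] is total, so [Gamma s] carries meaning only once convergence of the integral is
    established. *)
Lemma Gamma_spec s : 0 < s ->
  is_RInt_gen (gamma_integrand s) (at_right 0) (Rbar_locally p_infty) (Gamma s)
  /\ 0 < Gamma s.
Proof.
  intros Hs. destruct (gamma_integral_bound s Hs) as [M HM].
  destruct (is_RInt_gen_nonneg_bounded (gamma_integrand s) M) as [l [Hl Hle]].
  - intros; apply Rlt_le, gamma_integrand_pos.
  - apply gamma_integrand_cont.
  - exact HM.
  - assert (HG : Gamma s = l)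
      by exact (@is_RInt_gen_unique R_CompleteNormedModule _ _ _ _ (gamma_integrand s) l Hl).
    rewrite HG. split; [exact Hl|].
    apply Rlt_le_trans with (RInt (gamma_integrand s) 1 2); [|apply Hle; lra].
    apply RInt_gt_0; [lra| |].
    + intros; apply gamma_integrand_pos.
    + intros; apply gamma_integrand_cont; lra.
Qed.

Lemma Gamma_pos s : 0 < s -> 0 < Gamma s.
Proof. intros Hs. apply (Gamma_spec s Hs). Qed.

Lemma gamma_primitive_lim_0 s : 0 < s -> filterlim (gamma_primitive s) (at_right 0) (locally 0).
Proof.
  intros Hs P [eps HP].
  exists (mkposreal (Rpower eps (/ s)) (exp_pos _)). intros t Ht Ht0. apply HP.
  unfold ball in *; simpl in *; unfold AbsRing_ball, abs, minus, plus, opp in *; simpl in *.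
  apply Rabs_def2 in Ht.
  assert (Hp : 0 < gamma_primitive s t) by (apply Rmult_lt_0_compat; apply exp_pos).
  assert (H1 : Rpower t s < eps).
  { apply Rlt_le_trans with (Rpower (Rpower eps (/ s)) s).
    - apply Rlt_Rpower_l; lra.
    - rewrite Rpower_mult, Rinv_l, Rpower_1 by (try apply cond_pos; lra). lra. }
  assert (H2 : exp (- t) < 1) by (rewrite <- exp_0; apply exp_increasing; lra).
  apply Rabs_def1; [|pose proof (cond_pos eps); lra].
  pose proof (exp_pos (- t)). unfold gamma_primitive in *.
  assert (0 < Rpower t s) by apply exp_pos. nra.
Qed.

Lemma gamma_primitive_lim_infty s : 0 < s ->
  filterlim (gamma_primitive s) (Rbar_locally p_infty) (locally 0).
Proof.
  intros Hs P [eps HP]. set (B := exp (s * ln (2 * s) - s)).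
  assert (HB : 0 < B) by apply exp_pos. pose proof (cond_pos eps) as He.
  assert (HBe : 0 < B / eps) by (apply Rdiv_lt_0_compat; assumption).
  exists (2 * B / eps). intros t Ht. apply HP.
  replace (2 * B / eps) with (2 * (B / eps)) in Ht by (field; lra).
  unfold ball; simpl; unfold AbsRing_ball, abs, minus, plus, opp; simpl.
  assert (Hp : 0 < gamma_primitive s t) by (apply Rmult_lt_0_compat; apply exp_pos).
  apply Rabs_def1; [|lra].
  pose proof (gamma_primitive_le s t Hs ltac:(lra)) as Hle. fold B in Hle.
  assert (Hex : exp (- t / 2) * (1 + t / 2) <= 1).
  { replace 1 with (exp (- t / 2) * exp (t / 2)) at 2
      by (rewrite <- exp_plus; replace (- t / 2 + t / 2) with 0 by field; apply exp_0).
    apply Rmult_le_compat_l; [apply Rlt_le, exp_pos | apply exp_ineq1_le]. }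
  pose proof (exp_pos (- t / 2)).
  assert (B < eps * (t / 2)).
  { apply Rmult_lt_reg_r with (/ eps); [apply Rinv_0_lt_compat, He|].
    replace (eps * (t / 2) * / eps) with (t / 2) by (field; lra).
    unfold Rdiv in *. lra. }
  nra.
Qed.

(** Integration by parts: t^s e^(-t) tends to 0 at both ends, so its derivative has integral 0. *)
Lemma Gamma_succ s : 0 < s -> Gamma (s + 1) = s * Gamma s.
Proof.
  intros Hs.
  destruct (Gamma_spec s Hs) as [H1 _]. destruct (Gamma_spec (s + 1) ltac:(lra)) as [H2 _].
  pose proof (is_RInt_gen_minus _ _ _ _ (is_RInt_gen_scal _ s _ H1) H2) as H3.
  assert (H4 : is_RInt_gen (Derive (gamma_primitive s)) (at_right 0) (Rbar_locally p_infty) (0 - 0)).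
  { apply is_RInt_gen_Derive.
    - apply (filter_prod_pos_interval (ex_derive (gamma_primitive s))).
      intros t Ht. eexists. apply gamma_primitive_derive, Ht.
    - apply (filter_prod_pos_interval (continuous (Derive (gamma_primitive s)))).
      intros t Ht.
      apply (continuous_ext_loc _ (fun t => s * gamma_integrand s t - gamma_integrand (s + 1) t)).
      + exists (mkposreal t Ht). intros y Hy. symmetry. apply is_derive_unique, gamma_primitive_derive.
        unfold ball in Hy; simpl in Hy; unfold AbsRing_ball, abs, minus, plus, opp in Hy; simpl in Hy.
        apply Rabs_def2 in Hy. lra.
      + apply (@continuous_minus R_UniformSpace R_AbsRing R_NormedModule).
        * apply (@continuous_scal_r R_UniformSpace R_AbsRing R_NormedModule).
          apply gamma_integrand_cont, Ht.
        * apply gamma_integrand_cont, Ht.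
    - apply gamma_primitive_lim_0, Hs.
    - apply gamma_primitive_lim_infty, Hs. }
  assert (H5 : is_RInt_gen (Derive (gamma_primitive s)) (at_right 0) (Rbar_locally p_infty)
     (minus (scal s (Gamma s)) (Gamma (s + 1)))).
  { refine (is_RInt_gen_ext _ _ _ _ H3).
    refine (filter_imp _ _ _ (filter_prod_pos_interval (fun t =>
      minus (scal s (gamma_integrand s t)) (gamma_integrand (s + 1) t)
       = Derive (gamma_primitive s) t) _)).
    - intros ab H t Ht. apply H. lra.
    - intros t Ht. symmetry. apply is_derive_unique, gamma_primitive_derive, Ht. }
  pose proof (@is_RInt_gen_unique R_CompleteNormedModule _ _ _ _ _ _ H4) as H6.
  pose proof (@is_RInt_gen_unique R_CompleteNormedModule _ _ _ _ _ _ H5) as H7.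
  rewrite H6 in H7. unfold minus, plus, opp, scal in H7; simpl in H7.
  unfold mult in H7; simpl in H7. lra.
Qed.

(* The integral of [t^(s-1) exp (- t) (1 - r sqrt t)^2] is nonnegative for every [r]. *)
Lemma Gamma_log_convex s : 0 < s -> Gamma (s + 1 / 2) ^ 2 <= Gamma s * Gamma (s + 1).
Proof.
  intros Hs.
  destruct (Gamma_spec s Hs) as [H1 P1]. destruct (Gamma_spec (s + 1) ltac:(lra)) as [H2 P2].
  destruct (Gamma_spec (s + 1 / 2) ltac:(lra)) as [H3 P3].
  assert (Hq : forall r, 0 <= Gamma s + r ^ 2 * Gamma (s + 1) - 2 * r * Gamma (s + 1 / 2)).
  { intros r.
    pose proof (is_RInt_gen_minus _ _ _ _
      (is_RInt_gen_plus _ _ _ _ H1 (is_RInt_gen_scal _ (r ^ 2) _ H2))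
      (is_RInt_gen_scal _ (2 * r) _ H3)) as H4.
    refine (Rle_trans _ _ _ (norm_ge_0 _) (RInt_gen_norm _ _ _ _ _ _ H4 H4)).
    - apply Filter_prod with (fun a => 0 < a < 1) (fun b => 1 < b).
      + exists (mkposreal 1 Rlt_0_1). intros y Hy Hy0. split; [exact Hy0|].
        unfold ball in Hy; simpl in Hy; unfold AbsRing_ball, abs, minus, plus, opp in Hy; simpl in Hy.
        apply Rabs_def2 in Hy. lra.
      + exists 1. intros y Hy. exact Hy.
      + intros a b Ha Hb. simpl. lra.
    - apply Filter_prod with (fun a => 0 < a) (fun b => True).
      + exists (mkposreal 1 Rlt_0_1). intros y _ Hy. exact Hy.
      + exists 0. intros; exact I.
      + intros a b Ha _ t [Ht _]. simpl in Ht.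
        rewrite gamma_integrand_succ, gamma_integrand_half by lra.
        unfold norm, minus, plus, opp, scal; simpl; unfold abs, mult; simpl.
        apply Req_le, Rabs_pos_eq.
        pose proof (gamma_integrand_pos s t) as Hg.
        pose proof (sqrt_sqrt t ltac:(lra)) as Hsq.
        set (g := gamma_integrand s t) in *. set (q := sqrt t) in *.
        replace (g + r * (r * 1) * (t * g) + - (2 * r * (q * g)))
          with (g * (1 - r * q) ^ 2 + r * r * g * (t - q * q)) by ring.
        rewrite Hsq, Rminus_diag, Rmult_0_r, Rplus_0_r.
        apply Rmult_le_pos; [lra|apply pow2_ge_0]. }
  (* The minimizer of the quadratic in [r]; nonnegativity there is the discriminant inequality. *)
  specialize (Hq (Gamma (s + 1 / 2) / Gamma (s + 1))).
  set (A := Gamma s) in *. set (B := Gamma (s + 1)) in *. set (D := Gamma (s + 1 / 2)) in *.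
  replace (A + (D / B) ^ 2 * B - 2 * (D / B) * D) with ((A * B - D ^ 2) / B) in Hq by (field; lra).
  assert (H0 : 0 <= (A * B - D ^ 2) / B * B) by (apply Rmult_le_pos; lra).
  replace ((A * B - D ^ 2) / B * B) with (A * B - D ^ 2) in H0 by (field; lra). lra.
Qed.

(* With [a = l + 1/2] this is [Gamma (a / 2) / Gamma ((a + 1) / 2)]. *)
Definition gratio (l : nat) : R :=
  Gamma (INR l / 2 + 1 / 4) / Gamma (INR l / 2 + 3 / 4).

Lemma gratio_pos l : 0 < gratio l.
Proof.
  pose proof (pos_INR l).
  apply Rdiv_lt_0_compat; apply Gamma_pos; lra.
Qed.

(** The numerator of [gratio (S l)] is the denominator of [gratio l]; the remaining quotient is the
    functional equation. *)
Lemma gratio_mul_S l : gratio l * gratio (S l) = 2 / (INR l + 1 / 2).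
Proof.
  unfold gratio. pose proof (pos_INR l). rewrite S_INR.
  replace ((INR l + 1) / 2 + 1 / 4) with (INR l / 2 + 3 / 4) by field.
  replace ((INR l + 1) / 2 + 3 / 4) with (INR l / 2 + 1 / 4 + 1) by field.
  rewrite Gamma_succ by lra.
  pose proof (Gamma_pos (INR l / 2 + 1 / 4) ltac:(lra)).
  pose proof (Gamma_pos (INR l / 2 + 3 / 4) ltac:(lra)).
  field. repeat split; lra.
Qed.

Lemma gratio_decr l : gratio (S l) <= gratio l.
Proof.
  unfold gratio. pose proof (pos_INR l). rewrite S_INR.
  replace ((INR l + 1) / 2 + 1 / 4) with (INR l / 2 + 1 / 4 + 1 / 2) by field.
  replace ((INR l + 1) / 2 + 3 / 4) with (INR l / 2 + 1 / 4 + 1) by field.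
  replace (INR l / 2 + 3 / 4) with (INR l / 2 + 1 / 4 + 1 / 2) by field.
  set (s := INR l / 2 + 1 / 4).
  assert (Hs : 0 < s) by (unfold s; lra).
  pose proof (Gamma_log_convex s Hs) as Hc.
  pose proof (Gamma_pos s Hs). pose proof (Gamma_pos (s + 1) ltac:(lra)).
  pose proof (Gamma_pos (s + 1 / 2) ltac:(lra)).
  apply Rle_div_l; [assumption|].
  replace (Gamma s / Gamma (s + 1 / 2) * Gamma (s + 1))
    with (Gamma s * Gamma (s + 1) / Gamma (s + 1 / 2)) by (field; lra).
  apply Rle_div_r; [assumption|]. nra.
Qed.

Lemma gratio_SS l :
  (2 * INR l + 3) ^ 2 * gratio (S (S l)) ^ 2 = (2 * INR l + 1) ^ 2 * gratio l ^ 2.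
Proof.
  pose proof (gratio_mul_S l) as H1. pose proof (gratio_mul_S (S l)) as H2.
  rewrite S_INR in H2. pose proof (pos_INR l).
  pose proof (gratio_pos (S l)) as Hp.
  apply Rmult_eq_reg_r with (gratio (S l) ^ 2); [|apply pow_nonzero; lra].
  replace ((2 * INR l + 3) ^ 2 * gratio (S (S l)) ^ 2 * gratio (S l) ^ 2)
    with ((2 * INR l + 3) ^ 2 * (gratio (S l) * gratio (S (S l))) ^ 2) by ring.
  replace ((2 * INR l + 1) ^ 2 * gratio l ^ 2 * gratio (S l) ^ 2)
    with ((2 * INR l + 1) ^ 2 * (gratio l * gratio (S l)) ^ 2) by ring.
  rewrite H1, H2. field. lra.
Qed.

Lemma gratio_0_1 : gratio 0 * gratio 1 = 4.
Proof. rewrite gratio_mul_S. simpl. field. Qed.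

(** By monotonicity [gratio (S l) ^ 2] lies between its products with the two neighbours, and
    [gratio_mul_S] gives these exactly. *)
Lemma gratio_lim : is_lim_seq (fun l => INR l * gratio l ^ 2) 2.
Proof.
  apply is_lim_seq_incr_1.
  assert (Hinv : is_lim_seq (fun l => / (INR l + 1 / 2)) 0).
  { replace (Finite 0) with (Rbar_inv p_infty) by reflexivity.
    apply is_lim_seq_inv; [|discriminate].
    apply is_lim_seq_le_p_loc with (u := INR).
    - exists O. intros n _. lra.
    - apply is_lim_seq_INR. }
  apply is_lim_seq_le_le with (fun l => 2 - / (INR l + 1 / 2))
                              (fun l => 2 + / (INR l + 1 / 2)).
  - intros l. pose proof (gratio_mul_S l) as H1. pose proof (gratio_mul_S (S l)) as H2.
    pose proof (gratio_decr l). pose proof (gratio_decr (S l)).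
    pose proof (gratio_pos l). pose proof (gratio_pos (S l)). pose proof (gratio_pos (S (S l))).
    rewrite S_INR in *. pose proof (pos_INR l).
    set (x := INR l) in *.
    split.
    + apply Rle_trans with ((x + 1) * (2 / (x + 1 + 1 / 2))).
      * replace ((x + 1) * (2 / (x + 1 + 1 / 2))) with (2 - / (x + 1 + 1 / 2)) by (field; lra).
        assert (/ (x + 1 + 1 / 2) <= / (x + 1 / 2)) by (apply Rinv_le_contravar; lra). lra.
      * rewrite <- H2. apply Rmult_le_compat_l; nra.
    + apply Rle_trans with ((x + 1) * (2 / (x + 1 / 2))).
      * rewrite <- H1. apply Rmult_le_compat_l; nra.
      * apply Req_le. field. lra.
  - replace (Finite 2) with (Finite (2 - 0)) by (f_equal; ring).
    apply is_lim_seq_minus'; [apply is_lim_seq_const|exact Hinv].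
  - replace (Finite 2) with (Finite (2 + 0)) by (f_equal; ring).
    apply is_lim_seq_plus'; [apply is_lim_seq_const|exact Hinv].
Qed.

(** * Stirling's formula and the value of the companion series *)

Lemma nonneg_of_derive_nonneg (f f' : R -> R) (u : R) :
  0 <= u -> f 0 = 0 -> (forall t, 0 <= t -> is_derive f t (f' t)) ->
  (forall t, 0 <= t -> 0 <= f' t) -> 0 <= f u.
Proof.
  intros Hu H0 Hd Hp.
  destruct (MVT_gen f 0 u f') as [c [Hc He]].
  - intros t Ht. rewrite Rmin_left in Ht by lra. apply Hd. lra.
  - intros t Ht. rewrite Rmin_left in Ht by lra. apply continuity_pt_filterlim.
    apply (@ex_derive_continuous R_AbsRing R_NormedModule). exists (f' t). apply Hd. lra.
  - rewrite Rmin_left in Hc by lra. pose proof (Hp c ltac:(lra)). nra.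
Qed.

(** The midpoint rule for the convex function 1 / (1 + t) on [0, u]; [ln_1p_le] is the trapezoidal
    rule. Both are exact to second order, which makes the increments in Stirling's formula
    summable. *)
Lemma ln_1p_ge u : 0 <= u -> 2 * u / (2 + u) <= ln (1 + u).
Proof.
  intros Hu.
  pose proof (nonneg_of_derive_nonneg (fun u => ln (1 + u) - 2 * u / (2 + u))
    (fun u => u ^ 2 / ((1 + u) * (2 + u) ^ 2)) u Hu) as H.
  cbv beta in H. enough (0 <= ln (1 + u) - 2 * u / (2 + u)) by lra. apply H.
  - rewrite !Rplus_0_r, ln_1. field.
  - intros t Ht. auto_derive; [repeat split; lra|]. field. lra.
  - intros t Ht. apply Rdiv_le_0_compat; [apply pow2_ge_0|].
    apply Rmult_lt_0_compat; [lra|apply pow_lt; lra].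
Qed.

Lemma ln_1p_le u : 0 <= u -> ln (1 + u) <= u * (2 + u) / (2 * (1 + u)).
Proof.
  intros Hu.
  pose proof (nonneg_of_derive_nonneg (fun u => u * (2 + u) / (2 * (1 + u)) - ln (1 + u))
    (fun u => u ^ 2 / (2 * (1 + u) ^ 2)) u Hu) as H.
  cbv beta in H. enough (0 <= u * (2 + u) / (2 * (1 + u)) - ln (1 + u)) by lra. apply H.
  - rewrite !Rplus_0_r, ln_1. field.
  - intros t Ht. auto_derive; [repeat split; lra|]. field. lra.
  - intros t Ht. apply Rdiv_le_0_compat; [apply pow2_ge_0|].
    apply Rmult_lt_0_compat; [lra|apply pow_lt; lra].
Qed.

Lemma ln_le_sub1 y : 0 < y -> ln y <= y - 1.
Proof.
  intros Hy. pose proof (exp_ineq1_le (ln y)) as H. rewrite exp_ln in H by exact Hy. lra.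
Qed.

(* The remainder in Stirling's formula: [ln N! = (N + 1/2) ln N - N + stirling_rem N]. *)
Definition stirling_rem (N : nat) : R :=
  ln (INR (fact N)) - (INR N + 1 / 2) * ln (INR N) + INR N.

(** The increment is (N + 1/2) ln(1 + 1/N) - 1, and the two logarithm bounds place it between 0 and
    a telescoping difference. *)
Lemma stirling_rem_step N : (0 < N)%nat ->
  0 <= stirling_rem N - stirling_rem (S N) <= / 4 * (/ INR N - / INR (S N)).
Proof.
  intros HN. assert (Hx : 0 < INR N) by (apply lt_0_INR; exact HN).
  unfold stirling_rem. rewrite fact_simpl, mult_INR, S_INR.
  rewrite ln_mult by (try apply INR_fact_lt_0; lra).
  set (x := INR N) in *.
  assert (Hl : ln (x + 1) = ln x + ln (1 + / x)).
  { rewrite <- ln_mult; [f_equal; field; lra | lra | pose proof (Rinv_0_lt_compat x Hx); lra]. }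
  assert (Hu : 0 < / x) by (apply Rinv_0_lt_compat, Hx).
  pose proof (ln_1p_ge (/ x) ltac:(lra)) as H1. pose proof (ln_1p_le (/ x) ltac:(lra)) as H2.
  rewrite Hl. set (L := ln (1 + / x)) in *.
  replace (2 * / x / (2 + / x)) with (2 / (2 * x + 1)) in H1 by (field; lra).
  replace (/ x * (2 + / x) / (2 * (1 + / x))) with ((2 * x + 1) / (2 * x * (x + 1))) in H2
    by (field; lra).
  assert (H3 : (x + 1 / 2) * (2 / (2 * x + 1)) <= (x + 1 / 2) * L)
    by (apply Rmult_le_compat_l; lra).
  assert (H4 : (x + 1 / 2) * L <= (x + 1 / 2) * ((2 * x + 1) / (2 * x * (x + 1))))
    by (apply Rmult_le_compat_l; lra).
  replace ((x + 1 / 2) * (2 / (2 * x + 1))) with 1 in H3 by (field; lra).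
  replace ((x + 1 / 2) * ((2 * x + 1) / (2 * x * (x + 1))))
    with (1 + / 4 * (/ x - / (x + 1))) in H4 by (field; lra).
  split; lra.
Qed.

Lemma is_lim_seq_inv_INR : is_lim_seq (fun n => / INR n) 0.
Proof.
  replace (Finite 0) with (Rbar_inv p_infty) by reflexivity.
  apply is_lim_seq_inv; [apply is_lim_seq_INR|discriminate].
Qed.

(** The limit is ln(2 pi) / 2 but is kept abstract. *)
Lemma stirling_rem_cv : exists c : R, is_lim_seq stirling_rem c.
Proof.
  destruct (ex_finite_lim_seq_decr (fun n => stirling_rem (S n)) (stirling_rem 1 - / 4)) as [c Hc].
  - intros n. pose proof (stirling_rem_step (S n) ltac:(lia)). lra.
  - intros n.
    assert (H : stirling_rem 1 - / 4 <= stirling_rem (S n) - / 4 * / INR (S n)).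
    { induction n as [|n IH].
      - simpl (INR 1). lra.
      - pose proof (stirling_rem_step (S n) ltac:(lia)). lra. }
    pose proof (Rinv_0_lt_compat (INR (S n)) (lt_0_INR (S n) ltac:(lia))). lra.
  - exists c. apply is_lim_seq_incr_1, Hc.
Qed.

Lemma half_poch_fact N : half_poch N * 4 ^ N * INR (fact N) = INR (fact (2 * N)).
Proof.
  induction N as [|N IH]; [simpl; ring|].
  replace (2 * S N)%nat with (S (S (2 * N))) by lia.
  rewrite !fact_simpl, !mult_INR, <- IH, !S_INR, mult_INR. simpl. field.
Qed.

(** The Stirling remainder of (1/2)_N = (2N)! / (4^N N!). The constants of the two factorials
    cancel, so it tends to 0. *)
Definition half_poch_rem (N : nat) : R := stirling_rem (2 * N) - stirling_rem N.

Lemma ln_fact N : ln (INR (fact N)) = (INR N + 1 / 2) * ln (INR N) - INR N + stirling_rem N.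
Proof. unfold stirling_rem. ring. Qed.

Lemma ln_half_poch N : (0 < N)%nat ->
  ln (half_poch N) = INR N * ln (INR N) - INR N + ln 2 / 2 + half_poch_rem N.
Proof.
  intros HN. assert (Hx : 0 < INR N) by (apply lt_0_INR; exact HN).
  pose proof (f_equal ln (half_poch_fact N)) as H.
  assert (H4 : 0 < 4 ^ N) by (apply pow_lt; lra).
  rewrite !ln_mult in H by
    (repeat apply Rmult_lt_0_compat; try apply half_poch_pos; try assumption; apply INR_fact_lt_0).
  rewrite !ln_fact, ln_pow in H by lra.
  rewrite mult_INR in H. change (INR 2) with 2 in H.
  rewrite ln_mult in H by lra.
  replace 4 with (2 * 2) in H by ring. rewrite ln_mult in H by lra.
  unfold half_poch_rem. lra.
Qed.

Lemma half_poch_rem_lim : is_lim_seq half_poch_rem 0.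
Proof.
  destruct stirling_rem_cv as [c Hc]. unfold half_poch_rem.
  replace (Finite 0) with (Finite (c - c)) by (f_equal; ring).
  apply is_lim_seq_minus'; [|exact Hc].
  apply (is_lim_seq_subseq stirling_rem c (fun N => (2 * N)%nat)); [|exact Hc].
  apply eventually_subseq. intros n. lia.
Qed.

Lemma ln_alpha N : (0 < N)%nat ->
  ln (alpha N) = ln 2 / 2 - ln (INR N) / 2 + half_poch_rem N - stirling_rem N.
Proof.
  intros HN. unfold alpha. rewrite ln_div by (try apply half_poch_pos; apply INR_fact_lt_0).
  rewrite ln_half_poch, ln_fact by exact HN. field.
Qed.

Lemma alpha_sq_lim (c : R) : is_lim_seq stirling_rem c ->
  is_lim_seq (fun N => INR N * alpha N ^ 2) (2 * exp (- (2 * c))).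
Proof.
  intros Hc. apply is_lim_seq_incr_1.
  apply is_lim_seq_ext with
    (fun N => exp (ln 2 + 2 * half_poch_rem (S N) - 2 * stirling_rem (S N))).
  - intros N. assert (Hx : 0 < INR (S N)) by (apply lt_0_INR; lia).
    pose proof (ln_alpha (S N) ltac:(lia)) as Hl. pose proof (alpha_pos (S N)) as Ha.
    replace (INR (S N) * alpha (S N) ^ 2)
      with (exp (ln (INR (S N)) + (ln (alpha (S N)) + ln (alpha (S N))))).
    + f_equal. rewrite Hl. field.
    + rewrite !exp_plus, !exp_ln by assumption. ring.
  - replace (2 * exp (- (2 * c))) with (exp (ln 2 + 2 * 0 - 2 * c)).
    + apply (is_lim_seq_continuous exp).
      * apply derivable_continuous_pt, derivable_pt_exp.
      * apply (is_lim_seq_incr_1 (fun N => ln 2 + 2 * half_poch_rem N - 2 * stirling_rem N)).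
        apply is_lim_seq_minus'.
        -- apply is_lim_seq_plus'; [apply is_lim_seq_const|].
           apply (is_lim_seq_scal_l half_poch_rem 2 0), half_poch_rem_lim.
        -- apply (is_lim_seq_scal_l stirling_rem 2 c), Hc.
    + replace (ln 2 + 2 * 0 - 2 * c) with (ln 2 + - (2 * c)) by ring.
      rewrite exp_plus, exp_ln by lra. reflexivity.
Qed.

Lemma tX_col0 l : tX l 0 = alpha l ^ 2.
Proof.
  unfold tX, alpha. rewrite Nat.add_0_r. simpl.
  pose proof (INR_fact_neq_0 l). field. assumption.
Qed.

(** In [k] the terms shrink at least as fast as [alpha k ^ 3], because (y + 1/2) / (y + 1)^2
    decreases for y >= 0. The term of index 1 supplies the gain of order 1/l, so the term of index 0
    dominates [sX l]. *)
Lemma tX_tail l k : tX l (S k) <= alpha l ^ 2 * (2 / (INR l + 1)) * alpha (S k) ^ 3.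
Proof.
  pose proof (pos_INR l) as Hl. pose proof (pow_lt _ 2 (alpha_pos l)) as Ha.
  set (L := INR l) in *. set (A := alpha l ^ 2) in *.
  induction k as [|k IH].
  - rewrite tX_Sk, tX_col0. fold A. rewrite alpha_S, alpha_0. simpl (INR 0). fold L.
    replace (A * ((L + 0 + 1 / 2) * (0 + 1 / 2) ^ 2 / ((0 + 1) * (L + 0 + 1) ^ 2)))
      with (A * / (L + 1) / 4 * ((L + 1 / 2) / (L + 1))) by (field; lra).
    replace (A * (2 / (L + 1)) * (1 * ((0 + 1 / 2) / (0 + 1))) ^ 3)
      with (A * / (L + 1) / 4 * 1) by (field; lra).
    apply Rmult_le_compat_l.
    + assert (0 < / (L + 1)) by (apply Rinv_0_lt_compat; lra). nra.
    + apply div_le_l; lra.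
  - rewrite tX_Sk, (alpha_S (S k)). fold L.
    pose proof (pos_INR (S k)) as Hk. set (K := INR (S k)) in *.
    rewrite Rpow_mult_distr, <- Rmult_assoc.
    apply Rmult_le_compat; [apply Rlt_le, tX_pos | | exact IH |].
    + apply Rdiv_le_0_compat; [apply Rmult_le_pos; [lra|apply pow2_ge_0]|].
      apply Rmult_lt_0_compat; [lra|apply pow_lt; lra].
    + apply div_le_l; [apply Rmult_lt_0_compat; [lra|apply pow_lt; lra]|].
      replace (((K + 1 / 2) / (K + 1)) ^ 3 * ((K + 1) * (L + K + 1) ^ 2))
        with ((K + 1 / 2) ^ 2 * ((K + 1 / 2) * (L + K + 1) ^ 2 / (K + 1) ^ 2)) by (field; lra).
      rewrite (Rmult_comm (L + K + 1 / 2)). apply Rmult_le_compat_l; [apply pow2_ge_0|].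
      apply le_div_r; [apply pow_lt; lra|].
      assert (0 <= L * K) by nra. assert (0 <= L * (L * K)) by nra.
      assert (0 <= L * (K * K)) by nra. nra.
Qed.

Lemma sX_asymp : is_lim_seq (fun l => sX l / alpha l ^ 2) 1.
Proof.
  set (T := Series (fun k => alpha (S k) ^ 3)).
  assert (HT : ex_series (fun k => alpha (S k) ^ 3))
    by (apply (ex_series_incr_1 (fun k => alpha k ^ 3)), alpha3_summable).
  apply is_lim_seq_le_le with (fun _ => 1) (fun l => 1 + 2 * T * / (INR l + 1)).
  - intros l. pose proof (pow_lt _ 2 (alpha_pos l)) as Ha. pose proof (pos_INR l).
    assert (Hs : sX l = alpha l ^ 2 + Series (fun k => tX l (S k))).
    { unfold sX. rewrite Series_incr_1, tX_col0 by apply tX_summable. reflexivity. }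
    assert (Ht : ex_series (fun k => tX l (S k)))
      by (apply (ex_series_incr_1 (tX l)), tX_summable).
    split.
    + apply le_div_r; [exact Ha|]. rewrite Hs.
      pose proof (Series_term_le _ O (fun i => Rlt_le _ _ (tX_pos l (S i))) Ht).
      pose proof (tX_pos l 1). lra.
    + apply div_le_l; [exact Ha|]. rewrite Hs.
      replace ((1 + 2 * T * / (INR l + 1)) * alpha l ^ 2)
        with (alpha l ^ 2 + alpha l ^ 2 * (2 / (INR l + 1)) * T) by (field; lra).
      apply Rplus_le_compat_l. unfold T. rewrite <- Series_scal_l.
      apply Series_le; [|apply ex_series_mult_l, HT].
      intros k. split; [apply Rlt_le, tX_pos|apply tX_tail].
  - apply is_lim_seq_const.
  - replace (Finite 1) with (Finite (1 + 2 * T * 0)) by (f_equal; ring).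
    apply is_lim_seq_plus'; [apply is_lim_seq_const|].
    apply (is_lim_seq_scal_l _ (2 * T) 0).
    apply is_lim_seq_ext with (fun l => / INR (S l)); [intros; rewrite S_INR; reflexivity|].
    apply (is_lim_seq_incr_1 (fun l => / INR l)), is_lim_seq_inv_INR.
Qed.

Lemma sX_gratio_ratio_lim (c : R) : is_lim_seq stirling_rem c ->
  is_lim_seq (fun l => sX l / gratio l ^ 2) (exp (- (2 * c))).
Proof.
  intros Hc.
  pose proof (is_lim_seq_mult' _ _ _ _ sX_asymp (alpha_sq_lim c Hc)) as H1.
  pose proof (is_lim_seq_div' _ _ _ _ H1 gratio_lim ltac:(lra)) as H2.
  replace (exp (- (2 * c))) with (1 * (2 * exp (- (2 * c))) / 2) by field.
  apply is_lim_seq_incr_1. apply is_lim_seq_incr_1 in H2.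
  revert H2. apply is_lim_seq_ext. intros l.
  pose proof (alpha_pos (S l)). pose proof (gratio_pos (S l)).
  pose proof (lt_0_INR (S l) ltac:(lia)).
  field. repeat split; lra.
Qed.

(* Both [sX l] and [gratio l ^ 2] satisfy the same two-step recurrence, so their quotient is
   2-periodic; since it converges, it is constant. *)
Lemma sX_gratio (c : R) : is_lim_seq stirling_rem c ->
  forall l, sX l = exp (- (2 * c)) * gratio l ^ 2.
Proof.
  intros Hc l.
  assert (Hper : forall i, sX (l + 2 * i) / gratio (l + 2 * i) ^ 2 = sX l / gratio l ^ 2).
  { induction i as [|i IH]; [rewrite Nat.mul_0_r, Nat.add_0_r; reflexivity|].
    rewrite <- IH. replace (l + 2 * S i)%nat with (S (S (l + 2 * i))) by lia.
    pose proof (sX_rec (l + 2 * i)) as H1. pose proof (gratio_SS (l + 2 * i)) as H2.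
    set (m := (l + 2 * i)%nat) in *. pose proof (pos_INR m).
    pose proof (gratio_pos m) as Hg. pose proof (gratio_pos (S (S m))) as Hg'.
    set (p := (2 * INR m + 3) ^ 2) in *.
    assert (Hp : 0 < p) by (apply pow_lt; lra).
    replace (sX (S (S m)) / gratio (S (S m)) ^ 2)
      with (p * sX (S (S m)) / (p * gratio (S (S m)) ^ 2)) by (field; lra).
    rewrite H1, H2. field. split; lra. }
  assert (Hl : is_lim_seq (fun i => sX (l + 2 * i) / gratio (l + 2 * i) ^ 2) (exp (- (2 * c)))).
  { apply (is_lim_seq_subseq (fun l => sX l / gratio l ^ 2) _ (fun i => (l + 2 * i)%nat));
      [|apply sX_gratio_ratio_lim, Hc].
    apply eventually_subseq. intros n. lia. }
  apply (is_lim_seq_ext _ (fun _ => sX l / gratio l ^ 2)) in Hl; [|exact Hper].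
  apply is_lim_seq_unique in Hl. rewrite Lim_seq_const in Hl.
  injection Hl as Hl. rewrite <- Hl. pose proof (gratio_pos l). field. lra.
Qed.

(** * Laplace's method *)

Lemma sum_n_S (a : nat -> R) n : sum_n a (S n) = sum_n a n + a (S n).
Proof. apply (sum_Sn a n). Qed.

Lemma sum_n_O (a : nat -> R) : sum_n a 0 = a O.
Proof. apply (sum_O a). Qed.

Lemma sum_n_le_Series (a : nat -> R) n :
  (forall i, 0 <= a i) -> ex_series a -> sum_n a n <= Series a.
Proof.
  intros Ha He. revert n. apply is_lim_seq_incr_compare; [exact (Series_correct a He)|].
  intros n. rewrite sum_n_S. specialize (Ha (S n)). lra.
Qed.

(** Chebyshev's inequality for the unnormalized measure [t]. The mean of [omega] is controlled on
    partial sums, and only from [K0] on, because the telescoping identities leave a boundary term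
    whose sign is known for large [K]. *)
Lemma window_mass (t omega : nat -> R) (lo L K0 : nat) (B C : R) :
  (forall k, 0 <= t k) -> (forall k, 0 <= omega k) -> 0 < B -> ex_series t ->
  (forall k, (k < lo \/ lo + L < k)%nat -> B <= omega k) ->
  (forall K, (K0 <= K)%nat -> sum_n (fun k => omega k * t k) K <= C * sum_n t K) ->
  (1 - C / B) * Series t <= sum_n (fun j => t (lo + j)%nat) L <= Series t.
Proof.
  intros Ht Hw HB He Hout HC.
  set (s := fun k => omega k * t k).
  assert (Hs : forall k, 0 <= s k) by (intros; apply Rmult_le_pos; auto).
  assert (HBi : 0 < / B) by (apply Rinv_0_lt_compat, HB).
  assert (Hts : forall k, (k < lo \/ lo + L < k)%nat -> t k <= / B * s k).
  { intros k Hk. unfold s. specialize (Hout k Hk). specialize (Ht k).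
    replace (/ B * (omega k * t k)) with (omega k / B * t k) by (field; lra).
    assert (1 <= omega k / B) by (apply le_div_r; lra). nra. }
  assert (H1 : forall k, (k < lo)%nat -> sum_n t k <= / B * sum_n s k).
  { induction k as [|k IH]; intros Hk.
    - rewrite !sum_n_O. apply Hts. lia.
    - rewrite !sum_n_S. specialize (IH ltac:(lia)). specialize (Hts (S k) ltac:(lia)). lra. }
  assert (H2 : forall j, (j <= L)%nat ->
    sum_n (fun j => t (lo + j)%nat) j <= sum_n t (lo + j) <=
    sum_n (fun j => t (lo + j)%nat) j + / B * sum_n s (lo + j)).
  { induction j as [|j IH]; intros Hj.
    - rewrite sum_n_O, Nat.add_0_r. destruct lo as [|lo].
      + rewrite !sum_n_O. specialize (Hs O). nra.
      + rewrite !sum_n_S. specialize (H1 lo ltac:(lia)). specialize (Hs (S lo)).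
        assert (0 <= sum_n t lo) by (rewrite sum_n_Reals; apply cond_pos_sum, Ht). nra.
    - rewrite !Nat.add_succ_r, !sum_n_S, !Nat.add_succ_r. specialize (IH ltac:(lia)).
      specialize (Hs (S (lo + j))). nra. }
  assert (H3 : forall K, sum_n t (lo + L + K) <=
    sum_n (fun j => t (lo + j)%nat) L + / B * sum_n s (lo + L + K)).
  { induction K as [|K IH].
    - rewrite Nat.add_0_r. apply H2. lia.
    - rewrite !Nat.add_succ_r, !sum_n_S. specialize (Hts (S (lo + L + K)) ltac:(lia)). lra. }
  split.
  - assert (Hl : is_lim_seq (fun K => (1 - C / B) * sum_n t (lo + L + K))
      ((1 - C / B) * Series t)).
    { apply (is_lim_seq_scal_l _ (1 - C / B) (Series t)).
      apply (is_lim_seq_subseq (sum_n t) (Series t) (fun K => (lo + L + K)%nat)).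
      - apply eventually_subseq. intros; lia.
      - exact (Series_correct t He). }
    refine (is_lim_seq_le_loc _ _ _ _ _ Hl (is_lim_seq_const _)).
    exists K0. intros K HK. specialize (H3 K). specialize (HC (lo + L + K)%nat ltac:(lia)).
    fold s in HC.
    assert (/ B * sum_n s (lo + L + K) <= / B * (C * sum_n t (lo + L + K)))
      by (apply Rmult_le_compat_l; lra).
    unfold Rdiv. lra.
  - apply Rle_trans with (sum_n t (lo + L)); [apply H2; lia|].
    apply sum_n_le_Series; assumption.
Qed.

(** The quotient a/b changes by a relative amount of at most about [eta] per step, so within [w]
    steps of the centre it keeps its value up to a factor [(1 - eta) ^ w], which Bernoulli's
    inequality bounds below. *)
Lemma window_compare (a b : nat -> R) (w : nat) (eta : R) :
  0 <= eta < 1 -> INR w * eta < 1 ->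
  (forall j, 0 < a j) -> (forall j, 0 < b j) ->
  (forall j, (j < 2 * w)%nat ->
     (1 - eta) * (a j * b (S j)) <= a (S j) * b j <= (1 + eta) * (a j * b (S j))) ->
  (1 - INR w * eta) * (a w / b w) * sum_n b (2 * w) <= sum_n a (2 * w) /\
  (1 - INR w * eta) * sum_n a (2 * w) <= a w / b w * sum_n b (2 * w).
Proof.
  intros He Hwe Ha Hb Hr.
  set (r := fun j => a j / b j).
  assert (Hrp : forall j, 0 < r j) by (intros; apply Rdiv_lt_0_compat; auto).
  assert (Hstep : forall j, (j < 2 * w)%nat ->
    (1 - eta) * r j <= r (S j) /\ (1 - eta) * r (S j) <= r j).
  { intros j Hj. destruct (Hr j Hj) as [H1 H2]. pose proof (Ha j). pose proof (Ha (S j)).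
    pose proof (Hb j). pose proof (Hb (S j)). unfold r. split.
    - apply le_div_r; [assumption|].
      replace ((1 - eta) * (a j / b j) * b (S j)) with ((1 - eta) * (a j * b (S j)) / b j)
        by (field; lra).
      apply div_le_l; lra.
    - apply le_div_r; [assumption|].
      replace ((1 - eta) * (a (S j) / b (S j)) * b j)
        with ((1 - eta) * (a (S j) * b j) / b (S j)) by (field; lra).
      apply div_le_l; [assumption|].
      (* (1 - eta)(1 + eta) <= 1 lets the same factor [1 - eta] serve in both directions. *)
      apply Rle_trans with ((1 - eta) * ((1 + eta) * (a j * b (S j)))).
      + apply Rmult_le_compat_l; lra.
      + assert (0 < a j * b (S j)) by nra. nra. }
  assert (Hup : forall i j, (j + i <= 2 * w)%nat ->
    (1 - eta) ^ i * r j <= r (j + i)%nat /\ (1 - eta) ^ i * r (j + i)%nat <= r j).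
  { induction i as [|i IH]; intros j Hj.
    - rewrite Nat.add_0_r. simpl. lra.
    - destruct (IH j ltac:(lia)) as [H1 H2].
      destruct (Hstep (j + i)%nat ltac:(lia)) as [H3 H4].
      rewrite Nat.add_succ_r. simpl.
      assert (0 <= (1 - eta) ^ i) by (apply pow_le; lra).
      split.
      + rewrite Rmult_assoc. refine (Rle_trans _ _ _ _ H3). apply Rmult_le_compat_l; lra.
      + refine (Rle_trans _ _ _ _ H2).
        replace ((1 - eta) * (1 - eta) ^ i * r (S (j + i)))
          with ((1 - eta) ^ i * ((1 - eta) * r (S (j + i)))) by ring.
        apply Rmult_le_compat_l; lra. }
  assert (Hbern : forall i, (i <= w)%nat -> 1 - INR w * eta <= (1 - eta) ^ i).
  { intros i Hi.
    assert (Hi' : 1 - INR i * eta <= (1 - eta) ^ i).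
    { clear Hi. induction i as [|i IH]; [simpl; lra|].
      rewrite S_INR. simpl. pose proof (pos_INR i). nra. }
    apply le_INR in Hi. nra. }
  assert (Hall : forall j, (j <= 2 * w)%nat ->
    (1 - INR w * eta) * r w <= r j /\ (1 - INR w * eta) * r j <= r w).
  { intros j Hj. pose proof (Hrp j). pose proof (Hrp w).
    destruct (Nat.le_ge_cases j w) as [H1|H1].
    - destruct (Hup (w - j)%nat j ltac:(lia)) as [H2 H3].
      replace (j + (w - j))%nat with w in * by lia.
      pose proof (Hbern (w - j)%nat ltac:(lia)). split; nra.
    - destruct (Hup (j - w)%nat w ltac:(lia)) as [H2 H3].
      replace (w + (j - w))%nat with j in * by lia.
      pose proof (Hbern (j - w)%nat ltac:(lia)). split; nra. }
  assert (Hab : forall j, a j = r j * b j).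
  { intros j. unfold r. pose proof (Hb j). field. lra. }
  fold (r w).
  assert (Hind : forall m, (m <= 2 * w)%nat ->
    (1 - INR w * eta) * r w * sum_n b m <= sum_n a m /\
    (1 - INR w * eta) * sum_n a m <= r w * sum_n b m).
  { induction m as [|m IH]; intros Hm.
    - rewrite !sum_n_O, (Hab O). destruct (Hall O ltac:(lia)). pose proof (Hb O). nra.
    - rewrite !sum_n_S, (Hab (S m)). destruct (Hall (S m) Hm). destruct (IH ltac:(lia)).
      pose proof (Hb (S m)). nra. }
  apply Hind. lia.
Qed.

(** Poisson weights of mean [N], without the normalization [exp (- N)]. *)
Definition poisson (N k : nat) : R := INR N ^ k / INR (fact k).

Lemma poisson_series N : is_series (poisson N) (exp (INR N)).
Proof.
  pose proof (is_exp_Reals (INR N)) as H. apply is_pseries_R in H.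
  revert H. apply is_series_ext. intros k. unfold poisson, Rdiv. apply Rmult_comm.
Qed.

Lemma poisson_pos N k : (0 < N)%nat -> 0 < poisson N k.
Proof.
  intros HN. apply Rdiv_lt_0_compat; [apply pow_lt, lt_0_INR, HN | apply INR_fact_lt_0].
Qed.

Lemma poisson_S N k : (INR k + 1) * poisson N (S k) = INR N * poisson N k.
Proof.
  unfold poisson. rewrite fact_simpl, mult_INR, S_INR. simpl.
  pose proof (pos_INR k). pose proof (INR_fact_neq_0 k). field. split; lra.
Qed.

(** By (k + 1) p_(k+1) = N p_k the difference of the two sides telescopes to a boundary term, of
    favourable sign once [N <= K]. *)
Lemma poisson_variance N K : (0 < N)%nat -> (N <= K)%nat ->
  sum_n (fun k => (INR k - INR N) ^ 2 * poisson N k) K <= INR N * sum_n (poisson N) K.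
Proof.
  intros HN HK.
  assert (H : sum_n (fun k => (INR k - INR N) ^ 2 * poisson N k) K
    = INR N * sum_n (poisson N) K - (INR K + 1 - INR N) * (INR N * poisson N K)).
  { clear HK. induction K as [|K IH].
    - rewrite !sum_n_O. cbv [INR]. match goal with |- @eq _ ?u ?v => change (@eq R u v) end. ring.
    - rewrite !sum_n_S, IH, <- poisson_S, !S_INR.
      match goal with |- @eq _ ?u ?v => change (@eq R u v) end. ring. }
  rewrite H. apply le_INR in HK. pose proof (poisson_pos N K HN). pose proof (pos_INR N).
  assert (0 <= (INR K + 1 - INR N) * (INR N * poisson N K)); [|lra].
  apply Rmult_le_pos; [lra|]. apply Rmult_le_pos; lra.
Qed.

(* Comparable to [(k - rho n)^2 / n] when [k] is of order [n], but bounded as [k] grows, so that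
   its mean exists although [tI n] has few moments. *)
Definition tI_weight (rho n k : R) : R :=
  n * (k - rho * n) ^ 2 * (k + (rho + 1) * n) / (n + k - 1 / 2) ^ 3.

(** The ratio of consecutive terms is governed by k (2n + k)^2 against (n + k - 1/2)^3, and k (2n +
    k)^2 - (n + k)^3 = n (k - rho n)(k + (rho + 1) n): hence the shape of the weight. Of the bound
    13, the lower-order terms account for 12 and summation by parts for 1. *)
Lemma tI_variance rho n K : 0 < rho < 1 -> rho ^ 2 + rho = 1 -> (0 < n)%nat ->
  rho * INR n <= INR K + 1 ->
  sum_n (fun k => tI_weight rho (INR n) (INR k) * tI n k) K <= 13 * sum_n (tI n) K.
Proof.
  intros Hr Hr2 Hn HK.
  assert (H : sum_n (fun k => tI_weight rho (INR n) (INR k) * tI n k) K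
    <= 13 * sum_n (tI n) K - (INR K + 1 - rho * INR n) * tI n K).
  { clear HK. apply (le_INR 1) in Hn. simpl in Hn. set (x := INR n) in *.
    assert (Hk : forall k, 0 <= k ->
      tI_weight rho x k <= 12 + (k - rho * x) * (k * (2 * x + k) ^ 2) / (x + k - 1 / 2) ^ 3
                          - (k - rho * x)).
    { intros k Hk. set (s := x + k - 1 / 2). assert (Hs : 1 / 2 <= s) by (unfold s; lra).
      assert (Hs3 : 0 < s ^ 3) by (apply pow_lt; lra).
      unfold tI_weight. fold s. apply div_le_l; [exact Hs3|].
      replace ((12 + (k - rho * x) * (k * (2 * x + k) ^ 2) / s ^ 3 - (k - rho * x)) * s ^ 3)
        with (12 * s ^ 3 + (k - rho * x) * (k * (2 * x + k) ^ 2 - s ^ 3)) by (field; lra).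
      assert (Hid : k * (2 * x + k) ^ 2 - s ^ 3 =
        x * (k - rho * x) * (k + (rho + 1) * x) + (3 / 2 * s ^ 2 + 3 / 4 * s + 1 / 8)).
      { replace (x * (k - rho * x) * (k + (rho + 1) * x))
          with (x * (k ^ 2 + x * k - (rho ^ 2 + rho) * x ^ 2)) by ring.
        rewrite Hr2. unfold s. field. }
      rewrite Hid.
      (* Only a lower bound for [k - rho * x] times the correction is required; with the correction
         at most 6 s^2 this costs 12 s^3. *)
      assert (Hd : - (2 * s) <= k - rho * x) by (unfold s; nra).
      assert (0 <= 3 / 2 * s ^ 2 + 3 / 4 * s + 1 / 8 <= 6 * s ^ 2) by (split; nra).
      assert (H1 : - (2 * s) * (3 / 2 * s ^ 2 + 3 / 4 * s + 1 / 8)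
        <= (k - rho * x) * (3 / 2 * s ^ 2 + 3 / 4 * s + 1 / 8))
        by (apply Rmult_le_compat_r; lra).
      assert (H2 : 2 * s * (3 / 2 * s ^ 2 + 3 / 4 * s + 1 / 8) <= 2 * s * (6 * s ^ 2))
        by (apply Rmult_le_compat_l; lra).
      replace (2 * s * (6 * s ^ 2)) with (12 * s ^ 3) in H2 by ring.
      nra. }
    induction K as [|K IH].
    - rewrite !sum_n_O. simpl (INR 0). pose proof (tI_pos n 0) as Ht.
      specialize (Hk 0 ltac:(lra)).
      replace ((0 - rho * x) * (0 * (2 * x + 0) ^ 2) / (x + 0 - 1 / 2) ^ 3) with 0 in Hk
        by (field; lra).
      assert (tI_weight rho x 0 * tI n 0 <= (12 - (0 - rho * x)) * tI n 0)
        by (apply Rmult_le_compat_r; lra).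
      lra.
    - rewrite !sum_n_S. pose proof (tI_pos n (S K)) as Ht.
      pose proof (pos_INR K) as HK0.
      specialize (Hk (INR (S K)) (pos_INR _)).
      assert (Hrec : INR (S K) * (2 * x + INR (S K)) ^ 2 * tI n (S K)
         = (x + INR (S K) - 1 / 2) ^ 3 * tI n K).
      { rewrite tI_Sk, S_INR. fold x. field. lra. }
      rewrite S_INR in *. set (k := INR K) in *.
      assert (H1 : tI_weight rho x (k + 1) * tI n (S K) <=
        (12 + (k + 1 - rho * x) * ((k + 1) * (2 * x + (k + 1)) ^ 2) / (x + (k + 1) - 1 / 2) ^ 3
           - (k + 1 - rho * x)) * tI n (S K)) by (apply Rmult_le_compat_r; lra).
      replace ((12 + (k + 1 - rho * x) * ((k + 1) * (2 * x + (k + 1)) ^ 2) / (x + (k + 1) - 1 / 2) ^ 3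
           - (k + 1 - rho * x)) * tI n (S K))
        with (12 * tI n (S K) - (k + 1 - rho * x) * tI n (S K) + (k + 1 - rho * x) *
          ((k + 1) * (2 * x + (k + 1)) ^ 2 * tI n (S K)) / (x + (k + 1) - 1 / 2) ^ 3) in H1
        by (field; lra).
      rewrite Hrec in H1.
      replace ((k + 1 - rho * x) * ((x + (k + 1) - 1 / 2) ^ 3 * tI n K) / (x + (k + 1) - 1 / 2) ^ 3)
        with ((k + 1 - rho * x) * tI n K) in H1 by (field; lra).
      lra. }
  pose proof (tI_pos n K).
  assert (0 <= (INR K + 1 - rho * INR n) * tI n K) by (apply Rmult_le_pos; lra).
  lra.
Qed.

(** With d = |k - rho n|, the cap A <= sqrt n gives A (n + k) <= 3 sqrt n d even for [k] far beyond
    [n]; squaring produces the 9. *)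
Lemma tI_weight_ge rho n k A : 0 < rho < 1 -> 1 <= n -> 0 <= k -> 0 <= A -> A <= sqrt n ->
  A * sqrt n <= Rabs (k - rho * n) -> A ^ 2 / 9 <= tI_weight rho n k.
Proof.
  intros Hr Hn Hk HA HAn Hd. pose proof (sqrt_sqrt n ltac:(lra)) as Hs.
  pose proof (sqrt_lt_R0 n ltac:(lra)) as Hs0.
  unfold tI_weight. rewrite <- (pow2_abs (k - rho * n)).
  set (d := Rabs (k - rho * n)) in *. set (q := sqrt n) in *.
  assert (Hnk : n + k <= 2 * n + d).
  { pose proof (Rle_abs (k - rho * n)). fold d in H. nra. }
  assert (Hd0 : 0 <= d) by apply Rabs_pos.
  assert (H1 : A * (n + k) <= 3 * q * d).
  { apply Rle_trans with (A * (2 * n + d)); [apply Rmult_le_compat_l; lra|].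
    assert (A * d <= q * d) by (apply Rmult_le_compat_r; lra).
    assert (A * n <= q * d) by (rewrite <- Hs; nra). lra. }
  assert (H2 : (A * (n + k)) ^ 2 <= (3 * q * d) ^ 2) by (apply pow_incr; split; [nra|exact H1]).
  assert (Hs3 : 0 < (n + k - 1 / 2) ^ 3) by (apply pow_lt; lra).
  assert (Hle : (n + k - 1 / 2) ^ 3 <= (n + k) ^ 3) by (apply pow_incr; lra).
  apply le_div_r; [exact Hs3|].
  apply Rle_trans with (A ^ 2 / 9 * (n + k) ^ 3).
  { apply Rmult_le_compat_l; [|exact Hle]. pose proof (pow2_ge_0 A). lra. }
  replace (A ^ 2 / 9 * (n + k) ^ 3) with ((A * (n + k)) ^ 2 / 9 * (n + k)) by field.
  apply Rmult_le_compat; [pose proof (pow2_ge_0 (A * (n + k))); lra | lra | | nra].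
  replace ((3 * q * d) ^ 2) with (9 * (q * q) * d ^ 2) in H2 by ring. rewrite Hs in H2. lra.
Qed.

(** The cross-multiplied difference between a consecutive ratio of [tI n] at distance [e] from its
    peak and the corresponding Poisson ratio; [dl] and [dp] are rounding errors. Each product has
    size n^4. At the peak the leading parts agree, and the choice of N also cancels the terms of
    order n^3 e. *)
Lemma ratio_numerator_bound (r n k N e dl dp m E : R) :
  r ^ 2 = 5 -> 2.2 < r < 2.3 -> 1 <= m -> m ^ 2 = n -> 1 <= E ->
  k = (r - 1) / 2 * n + e -> N = n * (1 + 2 * r / 5) - dp ->
  0 <= dl < 1 -> 0 <= dp < 1 -> 0 <= N -> 0 <= k <= 2 * n -> Rabs e <= E * m ->
  Rabs ((n + k + 1 / 2) ^ 3 * (N + (e + dl) + 1) - N * ((k + 1) * (2 * n + k + 1) ^ 2))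
  <= 300 * E ^ 2 * n ^ 3.
Proof.
  intros Hr Hr' Hm Hmn HE Hk HN Hdl Hdp HN0 Hk0 He.
  assert (Hn : 1 <= n) by nra. assert (Hmlen : m <= n) by nra.
  assert (HN2 : N <= 2 * n) by nra.
  assert (HE2 : 1 <= E ^ 2) by nra.
  set (y := (n + k + 1 / 2) ^ 3).
  set (Q := 3 / 2 * (n + k) ^ 2 + 3 / 4 * (n + k) + 1 / 8
    - ((2 * n + k) ^ 2 + 2 * k * (2 * n + k) + 2 * (2 * n + k) + k + 1)).
  set (h := e + 1 / 2). set (phi := (r + 1) / 2).
  assert (Hquad : k ^ 2 + n * k - n ^ 2 = e * (e + r * n)).
  { replace (k ^ 2 + n * k - n ^ 2) with ((r ^ 2 - 5) / 4 * n ^ 2 + e * (e + r * n))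
      by (rewrite Hk; field).
    rewrite Hr. lra. }
  assert (Hyz : y - (k + 1) * (2 * n + k + 1) ^ 2 = - n * (e * (e + r * n)) + Q).
  { rewrite <- Hquad. unfold y, Q. field. }
  assert (Hphi3 : phi ^ 3 = r + 2).
  { unfold phi. replace (((r + 1) / 2) ^ 3) with ((r * r ^ 2 + 3 * r ^ 2 + 3 * r + 1) / 8) by field.
    rewrite Hr. field. }
  assert (Hy : y = (phi * n + h) ^ 3).
  { unfold y, phi, h. rewrite Hk. f_equal. field. }
  assert (HNr : N * r = n * (r + 2) - dp * r).
  { rewrite HN. replace ((n * (1 + 2 * r / 5) - dp) * r) with (n * (r + 2 * r ^ 2 / 5) - dp * r)
      by field. rewrite Hr. field. }
  replace (y * (N + (e + dl) + 1) - N * ((k + 1) * (2 * n + k + 1) ^ 2))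
    with (N * (y - (k + 1) * (2 * n + k + 1) ^ 2) + (e + dl + 1) * y) by ring.
  rewrite Hyz.
  replace (N * (- n * (e * (e + r * n)) + Q) + (e + dl + 1) * y)
    with (- (N * n * e ^ 2) + N * Q - N * r * n ^ 2 * e + (dl + 1) * y + e * y) by ring.
  rewrite HNr. rewrite Hy at 2.
  replace (- (N * n * e ^ 2) + N * Q - (n * (r + 2) - dp * r) * n ^ 2 * e + (dl + 1) * y +
      e * (phi * n + h) ^ 3)
    with (- (N * n * e ^ 2) + N * Q + dp * r * n ^ 2 * e + (dl + 1) * y +
      e * h * (3 * phi ^ 2 * n ^ 2 + 3 * phi * n * h + h ^ 2)
      + n ^ 3 * e * (phi ^ 3 - (r + 2))) by ring.
  (* The cancellation at first order in [e]: phi^3 = r + 2, while N r is n (r + 2) up to rounding.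
     This dictates the Poisson mean. *)
  rewrite Hphi3, Rminus_diag, Rmult_0_r, Rplus_0_r.
  assert (Hphi : 1 < phi < 1.7) by (unfold phi; lra).
  assert (Hen : e ^ 2 <= E ^ 2 * n).
  { rewrite <- pow2_abs. rewrite <- Hmn, <- Rpow_mult_distr.
    apply pow_incr. split; [apply Rabs_pos|exact He]. }
  assert (Hae : Rabs e <= E * n) by nra.
  assert (He2 : Rabs e <= 2 * n) by (apply Rabs_le; nra).
  assert (Hh : Rabs h <= Rabs e + 1 / 2).
  { unfold h. refine (Rle_trans _ _ _ (Rabs_triang _ _) _).
    rewrite (Rabs_pos_eq (1 / 2)) by lra. lra. }
  assert (Heh : Rabs e * Rabs h <= 3 / 2 * E ^ 2 * n).
  { apply Rle_trans with (Rabs e * (Rabs e + 1 / 2)).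
    - apply Rmult_le_compat_l; [apply Rabs_pos|exact Hh].
    - replace (Rabs e * (Rabs e + 1 / 2)) with (Rabs e ^ 2 + Rabs e / 2) by field.
      rewrite pow2_abs. assert (E * n <= E ^ 2 * n) by nra. lra. }
  assert (Hn3 : 0 < n ^ 3) by (apply pow_lt; lra).
  (* The five remaining terms are at most 2, 86, 3, 86 and 54 times E^2 n^3; 300 rounds up the
     total. *)
  assert (HB1 : Rabs (N * n * e ^ 2) <= 2 * E ^ 2 * n ^ 3).
  { rewrite Rabs_pos_eq by (pose proof (pow2_ge_0 e); apply Rmult_le_pos; nra).
    replace (2 * E ^ 2 * n ^ 3) with (2 * n * n * (E ^ 2 * n)) by ring.
    apply Rmult_le_compat; [nra|apply pow2_ge_0| |exact Hen].
    apply Rmult_le_compat_r; lra. }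
  assert (HQ : Rabs Q <= 43 * n ^ 2) by (unfold Q; apply Rabs_le; nra).
  assert (HB2 : Rabs (N * Q) <= 86 * n ^ 3).
  { rewrite Rabs_mult, (Rabs_pos_eq N) by exact HN0.
    replace (86 * n ^ 3) with (2 * n * (43 * n ^ 2)) by ring.
    apply Rmult_le_compat; [lra|apply Rabs_pos|lra|exact HQ]. }
  assert (HB3 : Rabs (dp * r * n ^ 2 * e) <= 3 * E * n ^ 3).
  { rewrite Rabs_mult, (Rabs_pos_eq (dp * r * n ^ 2)).
    - replace (3 * E * n ^ 3) with (3 * n ^ 2 * (E * n)) by ring.
      apply Rmult_le_compat; [|apply Rabs_pos| |exact Hae].
      + apply Rmult_le_pos; [nra|apply pow2_ge_0].
      + apply Rmult_le_compat_r; [apply pow2_ge_0|nra].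
    - apply Rmult_le_pos; [nra|apply pow2_ge_0]. }
  assert (HB4 : Rabs ((dl + 1) * y) <= 86 * n ^ 3).
  { assert (Hy0 : 0 <= y) by (apply pow_le; lra).
    assert (Hy1 : y <= (7 / 2 * n) ^ 3) by (apply pow_incr; lra).
    replace ((7 / 2 * n) ^ 3) with (343 / 8 * n ^ 3) in Hy1 by field.
    rewrite Rabs_pos_eq by nra. nra. }
  assert (HB5 : Rabs (e * h * (3 * phi ^ 2 * n ^ 2 + 3 * phi * n * h + h ^ 2))
     <= 54 * E ^ 2 * n ^ 3).
  { rewrite !Rabs_mult.
    replace (54 * E ^ 2 * n ^ 3) with (3 / 2 * E ^ 2 * n * (36 * n ^ 2)) by field.
    apply Rmult_le_compat;
      [apply Rmult_le_pos; apply Rabs_pos|apply Rabs_pos|exact Heh|].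
    assert (Hh3 : - (3 * n) <= h <= 3 * n) by (apply Rabs_le_between; lra).
    assert (Hp2 : phi ^ 2 <= 2.89) by nra. assert (0 <= phi ^ 2) by nra.
    assert (0 <= n ^ 2) by nra. assert (phi ^ 2 * n ^ 2 <= 2.89 * n ^ 2) by nra.
    assert (h ^ 2 <= 9 * n ^ 2) by nra.
    assert (Hnh : - (3 * n ^ 2) <= n * h <= 3 * n ^ 2) by nra.
    assert (- (5.1 * n ^ 2) <= phi * (n * h) <= 5.1 * n ^ 2) by nra.
    apply Rabs_le. nra. }
  assert (HE3 : E * n ^ 3 <= E ^ 2 * n ^ 3)
    by (apply Rmult_le_compat_r; [apply Rlt_le, Hn3|clear - HE; nra]).
  assert (HE4 : 1 * n ^ 3 <= E ^ 2 * n ^ 3)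
    by (apply Rmult_le_compat_r; [apply Rlt_le, Hn3|exact HE2]).
  clear - HB1 HB2 HB3 HB4 HB5 HE3 HE4.
  set (X1 := N * n * e ^ 2) in *. set (X2 := N * Q) in *.
  set (X3 := dp * r * n ^ 2 * e) in *. set (X4 := (dl + 1) * y) in *.
  set (X5 := e * h * (3 * phi ^ 2 * n ^ 2 + 3 * phi * n * h + h ^ 2)) in *.
  apply Rabs_le_between in HB1, HB2, HB3, HB4, HB5. apply Rabs_le. lra.
Qed.

Definition rfloor (x : R) : nat := Z.to_nat (Int_part x).

Lemma rfloor_spec x : 0 <= x -> INR (rfloor x) <= x < INR (rfloor x) + 1.
Proof.
  intros Hx. destruct (base_Int_part x) as [H1 H2].
  assert (Hz : (0 <= Int_part x)%Z).
  { destruct (Z_lt_le_dec (Int_part x) 0) as [H|H]; [|exact H].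
    assert (H' : (Int_part x <= -1)%Z) by lia. apply IZR_le in H'. lra. }
  unfold rfloor. rewrite INR_IZR_INZ, Z2Nat.id by exact Hz. lra.
Qed.

Definition rt5 : R := sqrt 5.
Definition rho : R := (rt5 - 1) / 2.
(* [tI n] peaks at [k = rho n], with variance [(1 + 2 sqrt 5 / 5) n]; the comparison Poisson
   distribution has this variance. *)
Definition peak (n : nat) : nat := rfloor (rho * INR n).
Definition spread (n : nat) : nat := rfloor (INR n * (1 + 2 * rt5 / 5)).

Lemma rt5_sq : rt5 ^ 2 = 5.
Proof. unfold rt5. rewrite pow2_sqrt; lra. Qed.

Lemma rt5_bounds : 2.2 < rt5 < 2.3.
Proof.
  pose proof rt5_sq as H. assert (0 <= rt5) by apply sqrt_pos. split; nra.
Qed.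

Lemma rho_sq : rho ^ 2 + rho = 1.
Proof.
  unfold rho. replace (((rt5 - 1) / 2) ^ 2 + (rt5 - 1) / 2) with ((rt5 ^ 2 - 1) / 4) by field.
  rewrite rt5_sq. field.
Qed.

Lemma rho_bounds : 0.6 < rho < 0.65.
Proof. unfold rho. pose proof rt5_bounds. lra. Qed.

Lemma peak_spec n : INR (peak n) <= rho * INR n < INR (peak n) + 1.
Proof.
  apply rfloor_spec. pose proof rho_bounds. pose proof (pos_INR n). nra.
Qed.

Lemma spread_spec n : INR (spread n) <= INR n * (1 + 2 * rt5 / 5) < INR (spread n) + 1.
Proof.
  apply rfloor_spec. pose proof rt5_bounds. pose proof (pos_INR n). nra.
Qed.

Lemma tI_poisson_ratio (n w j : nat) (A : R) :
  1 <= A -> 10 * (A + 2) <= sqrt (INR n) -> INR w <= A * sqrt (INR n) + 1 ->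
  (w <= peak n)%nat -> (w <= spread n)%nat -> (j < 2 * w)%nat ->
  let eta := 300 * (A + 2) ^ 2 / INR n in
  let a := fun j => tI n (peak n - w + j) in
  let b := fun j => poisson (spread n) (spread n - w + j) in
  (1 - eta) * (a j * b (S j)) <= a (S j) * b j <= (1 + eta) * (a j * b (S j)).
Proof.
  intros HA Hn Hw Hwp Hwv Hj eta a b.
  unfold a, b. rewrite !Nat.add_succ_r.
  set (k := (peak n - w + j)%nat). set (k' := (spread n - w + j)%nat).
  pose proof (pos_INR n) as Hn0. pose proof (sqrt_pos (INR n)) as Hm0.
  pose proof (pow2_sqrt (INR n) Hn0) as Hm2.
  pose proof (peak_spec n) as Hp. pose proof (spread_spec n) as Hv.
  pose proof rt5_sq as Hr. pose proof rt5_bounds as Hrb. pose proof rho_bounds as Hrho.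
  set (m := sqrt (INR n)) in *. set (x := INR n) in *.
  assert (Hx : 900 <= x) by nra.
  assert (Hmx : 10 * (A + 2) * m <= x) by nra.
  assert (Hki : INR k = INR (peak n) - INR w + INR j).
  { unfold k. rewrite plus_INR, minus_INR by exact Hwp. reflexivity. }
  assert (Hk'i : INR k' = INR (spread n) - INR w + INR j).
  { unfold k'. rewrite plus_INR, minus_INR by exact Hwv. reflexivity. }
  assert (Hj' : INR j <= 2 * INR w).
  { apply Rlt_le. replace 2 with (INR 2) by reflexivity. rewrite <- mult_INR. apply lt_INR, Hj. }
  pose proof (pos_INR j) as Hj0. pose proof (pos_INR w) as Hw0.
  set (dl := rho * x - INR (peak n)). set (dp := x * (1 + 2 * rt5 / 5) - INR (spread n)).
  set (e := INR k - rho * x).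
  (* The distance from the peak is at most w + 1 <= A m + 2, and m >= 1. *)
  assert (He : Rabs e <= (A + 2) * m).
  { apply Rabs_le. unfold e. rewrite Hki. nra. }
  assert (HeB : - (x / 10) <= e <= x / 10).
  { apply Rabs_le_between. lra. }
  assert (HN : x <= INR (spread n)) by nra.
  pose proof (ratio_numerator_bound rt5 x (INR k) (INR (spread n)) e dl dp m (A + 2)) as HF.
  assert (Hek : INR k = rho * x + e) by (unfold e; ring).
  specialize (HF Hr Hrb ltac:(lra) Hm2 ltac:(lra) Hek ltac:(unfold dp; ring)
    ltac:(unfold dl; lra) ltac:(unfold dp; lra) (pos_INR _) ltac:(split; [apply pos_INR|]; nra) He).
  assert (Hk'e : INR (spread n) + (e + dl) + 1 = INR k' + 1).
  { unfold e, dl. rewrite Hki, Hk'i. ring. }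
  rewrite Hk'e in HF.
  rewrite tI_Sk. fold x.
  assert (HPS : poisson (spread n) (S k') = INR (spread n) * poisson (spread n) k' / (INR k' + 1)).
  { rewrite <- poisson_S. pose proof (pos_INR k'). field. lra. }
  rewrite HPS.
  set (N := INR (spread n)) in *. set (K := INR k) in *.
  set (y := (x + K + 1 / 2) ^ 3) in *. set (z := (K + 1) * (2 * x + K + 1) ^ 2) in *.
  assert (HK : x / 4 <= K) by nra.
  assert (Hz : x ^ 3 <= z).
  { unfold z. replace (x ^ 3) with (x / 4 * (2 * x) ^ 2) by field.
    apply Rmult_le_compat; [lra|apply pow2_ge_0|lra|apply pow_incr; lra]. }
  assert (Hx3 : 0 < x ^ 3) by (apply pow_lt; lra).
  (* Dividing the numerator error by this product, at least n^4, gives the relative error [eta]. *)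
  assert (HNz : x ^ 4 <= N * z).
  { replace (x ^ 4) with (x * x ^ 3) by ring. apply Rmult_le_compat; lra. }
  assert (Heta : 300 * (A + 2) ^ 2 * x ^ 3 <= eta * (N * z)).
  { replace (300 * (A + 2) ^ 2 * x ^ 3) with (eta * x ^ 4) by (unfold eta; field; lra).
    apply Rmult_le_compat_l; [|exact HNz]. unfold eta. apply Rdiv_le_0_compat; [nra|lra]. }
  apply Rabs_le_between in HF.
  pose proof (tI_pos n k) as Ht.
  assert (Hvp : (0 < spread n)%nat) by (apply INR_lt; simpl; fold N; lra).
  pose proof (poisson_pos (spread n) k' Hvp) as Hpo.
  pose proof (pos_INR k') as Hk'0. set (K' := INR k') in *.
  set (t := tI n k) in *. set (p := poisson (spread n) k') in *.
  assert (Hz0 : 0 < z) by lra.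
  assert (Hu : 0 < t * p / (z * (K' + 1))).
  { apply Rdiv_lt_0_compat; apply Rmult_lt_0_compat; lra. }
  replace (t * (y / z) * p) with (t * p / (z * (K' + 1)) * (y * (K' + 1))) by (field; lra).
  replace ((1 - eta) * (t * (N * p / (K' + 1))))
    with (t * p / (z * (K' + 1)) * (N * z - eta * (N * z))) by (field; lra).
  replace ((1 + eta) * (t * (N * p / (K' + 1))))
    with (t * p / (z * (K' + 1)) * (N * z + eta * (N * z))) by (field; lra).
  split; apply Rmult_le_compat_l; lra.
Qed.

(** One factor [1 - eps] pays for the mass outside the window, the other for the comparison inside
    it. In [A], 117 = 9 * 13 combines the constants of [tI_weight_ge] and [tI_variance]; the
    condition with (A + 2)^3 forces [w * eta <= eps]. *)
Lemma laplace_window (n : nat) (A eps : R) :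
  0 < eps <= 1 / 4 -> A = 117 / eps -> 10 * (A + 2) <= sqrt (INR n) ->
  600 * (A + 2) ^ 3 / eps <= sqrt (INR n) ->
  let q := sI n * poisson (spread n) (spread n) / (tI n (peak n) * exp (INR (spread n))) in
  (1 - eps) ^ 2 <= q /\ (1 - eps) ^ 2 * q <= 1.
Proof.
  intros Heps HA Hn Hn' q.
  assert (HA1 : 468 <= A) by (rewrite HA; apply le_div_r; lra).
  pose proof (pos_INR n) as Hn0. pose proof (pow2_sqrt (INR n) Hn0) as Hm2.
  pose proof (peak_spec n) as Hp. pose proof (spread_spec n) as Hv.
  pose proof rt5_bounds as Hrb. pose proof rho_bounds as Hrho.
  set (m := sqrt (INR n)) in *. set (x := INR n) in *.
  assert (Hx : 900 <= x) by nra.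
  assert (Hmx : 10 * (A + 2) * m <= x) by nra.
  set (w := S (rfloor (A * m))).
  destruct (rfloor_spec (A * m) ltac:(nra)) as [Hw1 Hw2].
  assert (Hw : A * m < INR w <= A * m + 1) by (unfold w; rewrite S_INR; lra).
  clear Hw1 Hw2. clearbody w.
  assert (Hwp : (w <= peak n)%nat) by (apply INR_le; nra).
  assert (Hwv : (w <= spread n)%nat) by (apply INR_le; nra).
  assert (Hvp : (0 < spread n)%nat) by (apply INR_lt; simpl; nra).
  assert (Hnp : (0 < n)%nat) by (apply INR_lt; simpl; fold x; lra).
  set (a := fun j => tI n (peak n - w + j)).
  set (b := fun j => poisson (spread n) (spread n - w + j)).
  set (eta := 300 * (A + 2) ^ 2 / x).
  assert (Hweta : INR w * eta <= eps).
  { unfold eta.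
    apply Rle_trans with ((A + 2) * m * (300 * (A + 2) ^ 2 / x)).
    - apply Rmult_le_compat_r; [apply Rdiv_le_0_compat; nra|nra].
    - rewrite <- Hm2.
      replace ((A + 2) * m * (300 * (A + 2) ^ 2 / m ^ 2)) with (300 * (A + 2) ^ 3 / m)
        by (field; nra).
      apply div_le_l; [nra|].
      assert (H : 600 * (A + 2) ^ 3 / eps * eps <= m * eps) by (apply Rmult_le_compat_r; lra).
      replace (600 * (A + 2) ^ 3 / eps * eps) with (600 * (A + 2) ^ 3) in H by (field; lra).
      assert (0 < (A + 2) ^ 3) by (apply pow_lt; lra). lra. }
  assert (Heta0 : 0 <= eta) by (apply Rdiv_le_0_compat; nra).
  assert (Hw1 : 1 <= INR w) by nra.
  assert (Heta1 : eta < 1) by nra.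
  destruct (window_compare a b w eta) as [Hc1 Hc2].
  - lra.
  - lra.
  - intros; apply tI_pos.
  - intros; apply poisson_pos, Hvp.
  - intros j Hj. refine (tI_poisson_ratio n w j A _ Hn (proj2 Hw) Hwp Hwv Hj). lra.
  - assert (Ha : a w = tI n (peak n)) by (unfold a; f_equal; lia).
    assert (Hb : b w = poisson (spread n) (spread n)) by (unfold b; f_equal; lia).
    rewrite Ha, Hb in Hc1, Hc2.
    destruct (window_mass (tI n) (fun k => tI_weight rho x (INR k)) (peak n - w) (2 * w) n
      (A ^ 2 / 9) 13) as [Ht1 Ht2].
    + intros; apply Rlt_le, tI_pos.
    + intros k. unfold tI_weight. pose proof (pos_INR k).
      apply Rdiv_le_0_compat; [|apply pow_lt; lra].
      apply Rmult_le_pos; [apply Rmult_le_pos; [lra|apply pow2_ge_0]|nra].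
    + nra.
    + apply tI_summable.
    + intros k Hk. apply tI_weight_ge; [lra|lra|apply pos_INR|lra|fold m; lra|fold m].
      destruct Hk as [Hk|Hk].
      * assert (Hk' : INR k + INR w <= INR (peak n)).
        { rewrite <- plus_INR. apply le_INR. lia. }
        rewrite Rabs_left1 by nra. lra.
      * assert (Hk' : INR (peak n) + INR w + 1 <= INR k).
        { rewrite <- plus_INR, <- S_INR. apply le_INR. lia. }
        rewrite Rabs_pos_eq by nra. lra.
    + intros K HK. apply le_INR in HK. fold x in HK.
      apply tI_variance; [lra|apply rho_sq|exact Hnp|fold x; nra].
    + destruct (window_mass (poisson (spread n)) (fun k => (INR k - INR (spread n)) ^ 2)
        (spread n - w) (2 * w) (spread n) (A ^ 2 * x) (INR (spread n))) as [Hu1 Hu2].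
      * intros; apply Rlt_le, poisson_pos, Hvp.
      * intros; apply pow2_ge_0.
      * nra.
      * exists (exp (INR (spread n))). apply poisson_series.
      * intros k Hk.
        assert (Hd : INR w <= Rabs (INR k - INR (spread n))).
        { destruct Hk as [Hk|Hk].
          - assert (Hk' : INR k + INR w <= INR (spread n)).
            { rewrite <- plus_INR. apply le_INR. lia. }
            rewrite Rabs_left1 by lra. lra.
          - assert (Hk' : INR (spread n) + INR w <= INR k).
            { rewrite <- plus_INR. apply le_INR. lia. }
            rewrite Rabs_pos_eq by lra. lra. }
        rewrite <- (pow2_abs (INR k - INR (spread n))), <- Hm2, <- Rpow_mult_distr.
        apply pow_incr. nra.
      * intros K HK. apply poisson_variance; assumption.
      * rewrite (is_series_unique _ _ (poisson_series (spread n))) in Hu1, Hu2.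
        fold a in Ht1, Ht2. fold b in Hu1, Hu2. fold (sI n) in Ht1, Ht2.
        unfold q. pose proof (sI_pos n) as HT. pose proof (exp_pos (INR (spread n))) as HU.
        pose proof (tI_pos n (peak n)) as Htp. pose proof (poisson_pos _ (spread n) Hvp) as Hup.
        assert (He1 : 13 / (A ^ 2 / 9) <= eps).
        { replace (13 / (A ^ 2 / 9)) with (117 / A / A) by (field; lra).
          replace (117 / A) with eps by (rewrite HA; field; lra). apply div_le_l; nra. }
        assert (He2 : INR (spread n) / (A ^ 2 * x) <= eps).
        { apply div_le_l; [nra|].
          assert (117 = eps * A) by (rewrite HA; field; lra).
          replace (eps * (A ^ 2 * x)) with (117 * A * x) by (rewrite H; ring). nra. }
        set (Wa := sum_n a (2 * w)) in *. set (Wb := sum_n b (2 * w)) in *.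
        set (T := sI n) in *. set (U := exp (INR (spread n))) in *.
        set (t0 := tI n (peak n)) in *. set (u0 := poisson (spread n) (spread n)) in *.
        set (g := INR w * eta) in *.
        assert (Hra : 0 < t0 / u0) by (apply Rdiv_lt_0_compat; assumption).
        assert (HWa : (1 - eps) * T <= Wa) by nra.
        assert (HWb : (1 - eps) * U <= Wb) by nra.
        assert (HraU : 0 < t0 / u0 * U) by nra.
        replace (T * u0 / (t0 * U)) with (T / (t0 / u0 * U)) by (field; lra).
        split.
        -- apply le_div_r; [exact HraU|].
           apply Rle_trans with ((1 - g) * (t0 / u0) * Wb); [|lra].
           replace ((1 - eps) ^ 2 * (t0 / u0 * U))
             with ((1 - eps) * (t0 / u0) * ((1 - eps) * U)) by ring.
           apply Rmult_le_compat; [nra|nra| |exact HWb]. apply Rmult_le_compat_r; lra.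
        -- replace ((1 - eps) ^ 2 * (T / (t0 / u0 * U)))
             with ((1 - eps) * ((1 - eps) * T) / (t0 / u0 * U)) by (field; lra).
           apply div_le_l; [exact HraU|]. rewrite Rmult_1_l.
           apply Rle_trans with ((1 - g) * Wa).
           ++ apply Rmult_le_compat; [lra|nra|lra|exact HWa].
           ++ apply Rle_trans with (1 := Hc2). apply Rmult_le_compat_l; lra.
Qed.

(** The Poisson total divided by its central weight grows like sqrt(2 pi N), so [sI n] is
    asymptotically its peak term times this width. *)
Lemma laplace_ratio_lim :
  is_lim_seq (fun n => sI n * poisson (spread n) (spread n) / (tI n (peak n) * exp (INR (spread n)))) 1.
Proof.
  apply is_lim_seq_spec. intros eps0. destruct eps0 as [eps0 Heps0]. simpl.
  (* The bound 1/4 ensures (1 - eps)^2 (1 + 4 eps) >= 1, and the 8 leaves room for the error 4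
     eps. *)
  set (eps := Rmin (1 / 4) (eps0 / 8)).
  assert (Heps : 0 < eps <= 1 / 4).
  { unfold eps. split; [apply Rmin_pos; lra|apply Rmin_l]. }
  assert (Heps' : eps <= eps0 / 8) by apply Rmin_r.
  set (A := 117 / eps). set (S0 := Rmax (10 * (A + 2)) (600 * (A + 2) ^ 3 / eps)).
  exists (S (rfloor (S0 ^ 2))). intros n Hn.
  assert (Hsq : S0 <= sqrt (INR n)).
  { destruct (rfloor_spec (S0 ^ 2) (pow2_ge_0 _)) as [_ H].
    apply le_INR in Hn. rewrite S_INR in Hn.
    refine (Rle_trans _ _ _ (Rle_abs S0) _). rewrite <- sqrt_Rsqr_abs.
    apply sqrt_le_1_alt. unfold Rsqr. nra. }
  destruct (laplace_window n A eps Heps eq_refl) as [H1 H2].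
  - refine (Rle_trans _ _ _ (Rmax_l _ _) Hsq).
  - refine (Rle_trans _ _ _ (Rmax_r _ _) Hsq).
  - set (q := sI n * poisson (spread n) (spread n) / (tI n (peak n) * exp (INR (spread n)))) in *.
    assert (H3 : q <= 1 + 4 * eps).
    { assert (H4 : 1 <= (1 - eps) ^ 2 * (1 + 4 * eps)).
      { assert (0 <= eps * (1 - 4 * eps)) by nra. assert (0 <= eps ^ 3) by (apply pow_le; lra). nra. }
      assert (0 < (1 - eps) ^ 2) by (apply pow_lt; lra).
      apply Rmult_le_reg_l with ((1 - eps) ^ 2); [assumption|]. lra. }
    apply Rabs_def1; nra.
Qed.

(** * Asymptotics of the minimal solution *)

Definition xlogx (x : R) : R := x * ln x - x.

(** The derivative of [xlogx] is [ln]. Both bounds come from ln y <= y - 1, used at y = (a + d)/a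
    and at its inverse. *)
Lemma xlogx_taylor a d : 0 < a -> 0 < a + d ->
  0 <= xlogx (a + d) - xlogx a - d * ln a <= d ^ 2 / a.
Proof.
  intros Ha Had. set (y := (a + d) / a).
  assert (Hy : 0 < y) by (apply Rdiv_lt_0_compat; assumption).
  assert (Hl : ln (a + d) = ln a + ln y).
  { rewrite <- ln_mult by assumption. f_equal. unfold y. field. lra. }
  assert (Hd : d = a * (y - 1)) by (unfold y; field; lra).
  assert (He : xlogx (a + d) - xlogx a - d * ln a = a * (y * ln y - y + 1)).
  { unfold xlogx. rewrite Hl, Hd. ring. }
  rewrite He.
  pose proof (ln_le_sub1 y Hy) as H1.
  pose proof (ln_le_sub1 (/ y) (Rinv_0_lt_compat y Hy)) as H2.
  rewrite ln_Rinv in H2 by exact Hy.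
  assert (H3 : y * (1 - / y) <= y * ln y) by (apply Rmult_le_compat_l; lra).
  replace (y * (1 - / y)) with (y - 1) in H3 by (field; lra).
  assert (H4 : y * ln y <= y * (y - 1)) by (apply Rmult_le_compat_l; lra).
  split.
  - apply Rmult_le_pos; lra.
  - replace (d ^ 2 / a) with (a * (y - 1) ^ 2) by (rewrite Hd; field; lra).
    apply Rmult_le_compat_l; [lra|]. nra.
Qed.

Lemma golden_rho : golden = 1 + rho.
Proof. unfold golden, rho, rt5. field. Qed.

Lemma golden_bounds : 1.6 < golden < 1.65.
Proof. rewrite golden_rho. pose proof rho_bounds. lra. Qed.

Lemma golden_rho_inv : golden * rho = 1.
Proof. rewrite golden_rho. pose proof rho_sq. lra. Qed.

Lemma ln_tI n k : (0 < n)%nat -> (0 < k)%nat ->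
  ln (tI n k) =
  3 * xlogx (INR n + INR k) + xlogx (INR n) - xlogx (INR k) - 2 * xlogx (2 * INR n + INR k)
  - ln (INR k) / 2 - ln (2 * INR n + INR k) + 2 * ln 2
  + (3 * half_poch_rem (n + k) + half_poch_rem n - stirling_rem k - 2 * stirling_rem (2 * n + k)).
Proof.
  intros Hn Hk. unfold tI.
  pose proof (half_poch_pos (n + k)). pose proof (half_poch_pos n).
  pose proof (INR_fact_lt_0 k). pose proof (INR_fact_lt_0 (2 * n + k)).
  assert (H3 : 0 < half_poch (n + k) ^ 3) by (apply pow_lt; assumption).
  assert (H4 : 0 < INR (fact (2 * n + k)) ^ 2) by (apply pow_lt; assumption).
  rewrite ln_div by (apply Rmult_lt_0_compat; assumption).
  rewrite !ln_mult, !ln_pow by assumption.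
  rewrite !ln_half_poch, !ln_fact by lia.
  rewrite !plus_INR, mult_INR. change (INR 2) with 2. replace (INR 3) with 3 by (simpl; ring).
  unfold xlogx. field.
Qed.

Lemma is_lim_seq_nat_div (u : nat -> nat) (l : R) :
  0 <= l -> (forall n, INR (u n) <= l * INR n < INR (u n) + 1) ->
  is_lim_seq (fun n => INR (u n) / INR n) l.
Proof.
  intros Hl Hu. apply is_lim_seq_incr_1.
  apply is_lim_seq_le_le with (fun n => l - / INR (S n)) (fun _ => l).
  - intros n. pose proof (lt_0_INR (S n) ltac:(lia)) as Hn. destruct (Hu (S n)) as [H1 H2].
    split; [apply le_div_r | apply div_le_l]; try lra.
    replace ((l - / INR (S n)) * INR (S n)) with (l * INR (S n) - 1) by (field; lra). lra.
  - replace (Finite l) with (Finite (l - 0)) by (f_equal; ring).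
    apply is_lim_seq_minus'; [apply is_lim_seq_const|].
    apply (is_lim_seq_incr_1 (fun n => / INR n)), is_lim_seq_inv_INR.
  - apply is_lim_seq_const.
Qed.

Lemma is_lim_seq_ln (u : nat -> R) (l : R) :
  0 < l -> is_lim_seq u l -> is_lim_seq (fun n => ln (u n)) (ln l).
Proof.
  intros Hl Hu. apply (is_lim_seq_continuous ln); [|exact Hu].
  apply continuity_pt_filterlim, (@ex_derive_continuous R_AbsRing R_NormedModule).
  auto_derive. exact Hl.
Qed.

Lemma is_lim_seq_comp_ge (u : nat -> R) (l : R) (f : nat -> nat) :
  is_lim_seq u l -> (forall n, (n <= f (S n))%nat) -> is_lim_seq (fun n => u (f n)) l.
Proof.
  intros Hu Hf. apply (filterlim_comp _ _ _ f u eventually eventually); [|exact Hu].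
  intros P [N HN]. exists (S N). intros n Hn. apply HN.
  destruct n as [|n]; [lia|]. specialize (Hf n). lia.
Qed.

(* Stationarity: [3 ln phi - ln rho - 2 ln phi^2 = 0] makes the first-order term vanish. *)
Lemma peak_exponent n : (2 <= n)%nat ->
  Rabs (3 * xlogx (INR n + INR (peak n)) + xlogx (INR n) - xlogx (INR (peak n))
    - 2 * xlogx (2 * INR n + INR (peak n)) + 5 * INR n * ln golden) <= 5 / INR n.
Proof.
  intros Hn. apply (le_INR 2) in Hn. change (INR 2) with 2 in Hn.
  pose proof (peak_spec n) as Hp. pose proof rho_bounds as Hr.
  pose proof golden_bounds as Hg. pose proof golden_rho as Hgr. pose proof rho_sq as Hr2.
  pose proof golden_rho_inv as Hinv.
  set (x := INR n) in *. set (k := INR (peak n)) in *.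
  set (d := k - rho * x). assert (Hd : -1 <= d <= 0) by (unfold d; lra).
  assert (Hk : 0 < k) by nra.
  assert (Hd2 : d ^ 2 <= 1) by nra.
  assert (Hlr : ln rho = - ln golden).
  { assert (H : ln (golden * rho) = 0) by (rewrite Hinv; apply ln_1).
    rewrite ln_mult in H by lra. lra. }
  assert (Hgg : 2 + rho = golden * golden) by (rewrite Hgr; nra).
  destruct (xlogx_taylor (golden * x) d ltac:(nra) ltac:(unfold d; nra)) as [A1 A2].
  destruct (xlogx_taylor (rho * x) d ltac:(nra) ltac:(unfold d; nra)) as [B1 B2].
  destruct (xlogx_taylor (golden * golden * x) d ltac:(nra) ltac:(unfold d; nra)) as [C1 C2].
  assert (HA : d ^ 2 / (golden * x) <= 1 / x)
    by (apply div_le_l; [nra|]; replace (1 / x * (golden * x)) with golden by (field; lra); lra).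
  assert (HB : d ^ 2 / (rho * x) <= 2 / x)
    by (apply div_le_l; [nra|]; replace (2 / x * (rho * x)) with (2 * rho) by (field; lra); lra).
  assert (HC : d ^ 2 / (golden * golden * x) <= 1 / x)
    by (apply div_le_l; [nra|];
        replace (1 / x * (golden * golden * x)) with (golden * golden) by (field; lra); nra).
  replace (golden * x + d) with (x + k) in * by (unfold d; rewrite Hgr; ring).
  replace (rho * x + d) with k in * by (unfold d; ring).
  replace (golden * golden * x + d) with (2 * x + k) in * by (rewrite <- Hgg; unfold d; ring).
  assert (E1 : xlogx (golden * x) = golden * x * (ln golden + ln x) - golden * x)
    by (unfold xlogx; rewrite ln_mult by lra; reflexivity).
  assert (E2 : xlogx (rho * x) = rho * x * (- ln golden + ln x) - rho * x)
    by (unfold xlogx; rewrite ln_mult, Hlr by lra; reflexivity).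
  assert (E3 : xlogx (golden * golden * x)
     = golden * golden * x * (2 * ln golden + ln x) - golden * golden * x)
    by (unfold xlogx; rewrite !ln_mult by (try lra; nra); ring).
  rewrite (ln_mult golden x) in A1, A2 by lra. rewrite (ln_mult rho x) in B1, B2 by lra.
  rewrite (ln_mult (golden * golden) x), (ln_mult golden golden) in C1, C2 by (try lra; nra).
  rewrite Hlr in B1, B2.
  assert (Hx : xlogx x = x * ln x - x) by reflexivity.
  set (RA := xlogx (x + k) - xlogx (golden * x) - d * (ln golden + ln x)) in *.
  set (RB := xlogx k - xlogx (rho * x) - d * (- ln golden + ln x)) in *.
  set (RC := xlogx (2 * x + k) - xlogx (golden * golden * x)
             - d * (ln golden + ln golden + ln x)) in *.
  assert (Hmain : 3 * xlogx (x + k) + xlogx x - xlogx k - 2 * xlogx (2 * x + k)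
     + 5 * x * ln golden = 3 * RA - RB - 2 * RC).
  { replace (xlogx (x + k)) with (RA + xlogx (golden * x) + d * (ln golden + ln x))
      by (unfold RA; ring).
    replace (xlogx k) with (RB + xlogx (rho * x) + d * (- ln golden + ln x))
      by (unfold RB; ring).
    replace (xlogx (2 * x + k)) with (RC + xlogx (golden * golden * x)
      + d * (ln golden + ln golden + ln x)) by (unfold RC; ring).
    rewrite E1, E2, E3, Hx, <- Hgg, Hgr. ring. }
  rewrite Hmain. unfold Rdiv in *. apply Rabs_le. lra.
Qed.

(** The denominator k! (2n + k)!^2 contributes -3 c and, through its square-root prefactors, the
    power n^(-3/2); the remainders of the Pochhammer symbols vanish in the limit. *)
Lemma tI_peak_lim (c : R) : is_lim_seq stirling_rem c ->
  is_lim_seq (fun n => ln (tI n (peak n)) + 5 * INR n * ln golden + 3 / 2 * ln (INR n))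
    (2 * ln 2 - 3 * c - 3 / 2 * ln golden).
Proof.
  intros Hc. pose proof rho_bounds as Hr. pose proof golden_bounds as Hg.
  pose proof golden_rho as Hgr. pose proof rho_sq as Hr2.
  assert (Hlr : ln rho = - ln golden).
  { assert (H : ln (golden * rho) = 0) by (rewrite golden_rho_inv; apply ln_1).
    rewrite ln_mult in H by lra. lra. }
  assert (Hl2r : ln (2 + rho) = 2 * ln golden).
  { replace (2 + rho) with (golden * golden) by (rewrite Hgr; nra). rewrite ln_mult by lra. ring. }
  set (err := fun n => 3 * xlogx (INR n + INR (peak n)) + xlogx (INR n) - xlogx (INR (peak n))
    - 2 * xlogx (2 * INR n + INR (peak n)) + 5 * INR n * ln golden).
  assert (Herr : is_lim_seq err 0).
  { apply is_lim_seq_abs_0.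
    apply is_lim_seq_le_le_loc with (fun _ => 0) (fun n => 5 * / INR n).
    - exists 2%nat. intros n Hn. split; [apply Rabs_pos|apply peak_exponent, Hn].
    - apply is_lim_seq_const.
    - replace (Finite 0) with (Finite (5 * 0)) by (f_equal; ring).
      apply (is_lim_seq_scal_l _ 5 0), is_lim_seq_inv_INR. }
  assert (Hpn : is_lim_seq (fun n => INR (peak n) / INR n) rho)
    by (apply is_lim_seq_nat_div; [lra|apply peak_spec]).
  assert (Hrem1 : is_lim_seq (fun n => half_poch_rem (n + peak n)) 0)
    by (apply (is_lim_seq_comp_ge half_poch_rem 0 (fun n => (n + peak n)%nat));
        [apply half_poch_rem_lim|intros; lia]).
  assert (Hrem2 : is_lim_seq (fun n => stirling_rem (2 * n + peak n)) c)
    by (apply (is_lim_seq_comp_ge stirling_rem c (fun n => (2 * n + peak n)%nat));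
        [exact Hc|intros; lia]).
  assert (Hrem3 : is_lim_seq (fun n => stirling_rem (peak n)) c).
  { apply (filterlim_comp _ _ _ peak stirling_rem eventually eventually); [|exact Hc].
    intros P [N HN]. exists (2 * (N + 2))%nat. intros n Hn. apply HN.
    apply INR_le. apply le_INR in Hn. rewrite mult_INR, plus_INR in Hn.
    change (INR 2) with 2 in Hn. pose proof (peak_spec n). pose proof (pos_INR N). nra. }
  apply is_lim_seq_ext_loc with (fun n =>
    err n - ln (INR (peak n) / INR n) / 2 - ln (2 + INR (peak n) / INR n) + 2 * ln 2
    + (3 * half_poch_rem (n + peak n) + half_poch_rem n - stirling_rem (peak n)
       - 2 * stirling_rem (2 * n + peak n))).
  - exists 2%nat. intros n Hn.
    assert (Hx : 2 <= INR n) by (apply (le_INR 2) in Hn; exact Hn).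
    assert (Hp : (0 < peak n)%nat).
    { apply INR_lt. simpl. pose proof (peak_spec n). nra. }
    assert (Hp' : 0 < INR (peak n)) by (apply lt_0_INR, Hp).
    rewrite ln_tI by (try exact Hp; lia). unfold err.
    rewrite ln_div by lra.
    replace (2 + INR (peak n) / INR n) with ((2 * INR n + INR (peak n)) / INR n) by (field; lra).
    rewrite ln_div by lra. field.
  - replace (2 * ln 2 - 3 * c - 3 / 2 * ln golden)
      with (0 - ln rho / 2 - ln (2 + rho) + 2 * ln 2 + (3 * 0 + 0 - c - 2 * c))
      by (rewrite Hlr, Hl2r; field).
    apply is_lim_seq_plus'; [apply is_lim_seq_plus'; [|apply is_lim_seq_const]|].
    + apply is_lim_seq_minus'; [apply is_lim_seq_minus'; [exact Herr|]|].
      * apply (is_lim_seq_scal_r (fun n => ln (INR (peak n) / INR n)) (/ 2) (ln rho)).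
        apply is_lim_seq_ln; [lra|exact Hpn].
      * apply is_lim_seq_ln; [lra|]. apply is_lim_seq_plus'; [apply is_lim_seq_const|exact Hpn].
    + apply is_lim_seq_minus'; [apply is_lim_seq_minus'; [apply is_lim_seq_plus'|exact Hrem3]|].
      * apply (is_lim_seq_scal_l _ 3 0), Hrem1.
      * apply half_poch_rem_lim.
      * apply (is_lim_seq_scal_l _ 2 c), Hrem2.
Qed.

Lemma ln_poisson_peak N : (0 < N)%nat ->
  ln (poisson N N) = INR N - ln (INR N) / 2 - stirling_rem N.
Proof.
  intros HN. assert (H : 0 < INR N) by (apply lt_0_INR, HN).
  unfold poisson. rewrite ln_div by (try apply pow_lt; try apply INR_fact_lt_0; exact H).
  rewrite ln_pow, ln_fact by exact H. field.
Qed.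

(** The peak constant multiplied by the Poisson width, asymptotically sqrt N e^c with N =
    [spread n]: this raises -3 c to -2 c and adds half the logarithm of the limit of
    [spread n / n]. *)
Definition sI_const (c : R) : R :=
  exp (2 * ln 2 - 2 * c - 3 / 2 * ln golden + ln (1 + 2 * rt5 / 5) / 2).

Lemma sI_asymp (c : R) : is_lim_seq stirling_rem c ->
  is_lim_seq (fun n => INR n * golden ^ (5 * n) * sI n) (sI_const c).
Proof.
  intros Hc. pose proof rt5_bounds as Hrb. pose proof golden_bounds as Hg.
  assert (Hvn : is_lim_seq (fun n => INR (spread n) / INR n) (1 + 2 * rt5 / 5)).
  { apply is_lim_seq_nat_div; [lra|]. intros n. pose proof (spread_spec n). lra. }
  assert (Hrem : is_lim_seq (fun n => stirling_rem (spread n)) c).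
  { apply (is_lim_seq_comp_ge stirling_rem c spread); [exact Hc|].
    intros n. apply INR_le. pose proof (spread_spec (S n)) as Hv. rewrite S_INR in Hv.
    pose proof (pos_INR n). nra. }
  set (L := fun n => ln (tI n (peak n)) + 5 * INR n * ln golden + 3 / 2 * ln (INR n)).
  apply is_lim_seq_ext_loc with (fun n =>
    sI n * poisson (spread n) (spread n) / (tI n (peak n) * exp (INR (spread n)))
    * exp (L n + ln (INR (spread n) / INR n) / 2 + stirling_rem (spread n))).
  - exists 2%nat. intros n Hn.
    assert (Hx : 2 <= INR n) by (apply (le_INR 2) in Hn; exact Hn).
    assert (Hv : (0 < spread n)%nat).
    { apply INR_lt. simpl. pose proof (spread_spec n). nra. }
    assert (Hv' : 0 < INR (spread n)) by (apply lt_0_INR, Hv).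
    pose proof (tI_pos n (peak n)) as Ht. pose proof (poisson_pos (spread n) (spread n) Hv) as Hp.
    assert (HE : L n + ln (INR (spread n) / INR n) / 2 + stirling_rem (spread n)
      = ln (tI n (peak n)) + INR (spread n) - ln (poisson (spread n) (spread n))
        + (ln (INR n) + INR (5 * n) * ln golden)).
    { rewrite ln_poisson_peak by exact Hv. rewrite ln_div by lra. unfold L.
      rewrite mult_INR. replace (INR 5) with 5 by (simpl; ring). field. }
    rewrite HE. unfold Rminus. rewrite !exp_plus, exp_Ropp, !exp_ln by lra.
    rewrite <- ln_pow, exp_ln by (try apply pow_lt; lra).
    pose proof (exp_pos (INR (spread n))). field. repeat split; lra.
  - replace (sI_const c) with (1 * sI_const c) by ring.
    apply is_lim_seq_mult'; [exact laplace_ratio_lim|].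
    unfold sI_const.
    replace (2 * ln 2 - 2 * c - 3 / 2 * ln golden + ln (1 + 2 * rt5 / 5) / 2)
      with (2 * ln 2 - 3 * c - 3 / 2 * ln golden + ln (1 + 2 * rt5 / 5) / 2 + c) by ring.
    apply (is_lim_seq_continuous exp).
    + apply derivable_continuous_pt, derivable_pt_exp.
    + apply is_lim_seq_plus'; [apply is_lim_seq_plus'|exact Hrem].
      * apply tI_peak_lim, Hc.
      * apply (is_lim_seq_scal_r _ (/ 2) (ln (1 + 2 * rt5 / 5))).
        apply is_lim_seq_ln; [lra|exact Hvn].
Qed.

Lemma golden_pow3 : golden ^ 3 = rt5 + 2.
Proof.
  unfold golden. fold rt5.
  replace (((1 + rt5) / 2) ^ 3) with ((rt5 * rt5 ^ 2 + 3 * rt5 ^ 2 + 3 * rt5 + 1) / 8) by field.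
  rewrite rt5_sq. field.
Qed.

Lemma golden_pow5 : golden ^ 5 = (11 + 5 * rt5) / 2.
Proof.
  replace (golden ^ 5) with (golden ^ 3 * golden ^ 2) by ring. rewrite golden_pow3.
  unfold golden. fold rt5.
  replace ((rt5 + 2) * ((1 + rt5) / 2) ^ 2)
    with ((rt5 * rt5 ^ 2 + 4 * rt5 ^ 2 + 5 * rt5 + 2) / 4) by field.
  rewrite rt5_sq. field.
Qed.

Lemma sI_const_sq (c : R) : sI_const c ^ 2 = 16 * rt5 / 5 * exp (- (2 * c)) ^ 2.
Proof.
  pose proof rt5_bounds. pose proof golden_bounds. pose proof rt5_sq as Hr.
  unfold sI_const.
  replace (exp (- (2 * c)) ^ 2) with (exp (- (2 * c) + - (2 * c))) by (rewrite exp_plus; ring).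
  replace (exp (2 * ln 2 - 2 * c - 3 / 2 * ln golden + ln (1 + 2 * rt5 / 5) / 2) ^ 2)
    with (exp (INR 4 * ln 2 + - (INR 3 * ln golden) + ln (1 + 2 * rt5 / 5) +
            (- (2 * c) + - (2 * c)))).
  - rewrite (exp_plus _ (- (2 * c) + - (2 * c))). f_equal.
    rewrite !exp_plus, exp_Ropp, <- !ln_pow, !exp_ln by (try apply pow_lt; lra).
    rewrite golden_pow3.
    apply Rmult_eq_reg_r with (rt5 + 2); [|lra].
    replace (2 ^ 4 * / (rt5 + 2) * (1 + 2 * rt5 / 5) * (rt5 + 2)) with (16 + 32 / 5 * rt5)
      by (field; lra).
    replace (16 * rt5 / 5 * (rt5 + 2)) with (16 / 5 * rt5 ^ 2 + 32 / 5 * rt5) by field.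
    rewrite Hr. field.
  - simpl pow. rewrite Rmult_1_r, <- exp_plus. f_equal. simpl (INR 4). simpl (INR 3). field.
Qed.

(** * The continued fraction *)

Definition cf_rec (u : nat -> R) : Prop := forall j,
  u (S (S j)) = (44 * (INR j + 1) ^ 2 + 1) * u (S j) + (2 * INR j + 1) ^ 4 * u j.

Fixpoint cf_seq (x y : R) (j : nat) : R :=
  match j with
  | O => x
  | S i => match i with
           | O => y
           | S h => (44 * (INR h + 1) ^ 2 + 1) * cf_seq x y i
                    + (2 * INR h + 1) ^ 4 * cf_seq x y h
           end
  end.

Lemma cf_seq_rec x y : cf_rec (cf_seq x y).
Proof. intros j. reflexivity. Qed.

Lemma cf_rec_unique (u v : nat -> R) :
  cf_rec u -> cf_rec v -> u 0%nat = v 0%nat -> u 1%nat = v 1%nat -> forall j, u j = v j.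
Proof.
  intros Hu Hv H0 H1 j.
  assert (H : u j = v j /\ u (S j) = v (S j)); [|apply H].
  induction j as [|j [IH1 IH2]]; [split; assumption|].
  split; [exact IH2|]. rewrite Hu, Hv, IH1, IH2. reflexivity.
Qed.

(** The values at 0 come from running the recurrence backwards: 47 = 45 * 1 + 2 and 80 * 47 - 160 =
    45 * 80 + 0. This absorbs the exceptional coefficients 47 and -160, and the [n]-th convergent
    sits at index [n + 1]. *)
Definition num : nat -> R := cf_seq 0 80.
Definition den : nat -> R := cf_seq 2 1.

Lemma den_pos j : 0 < den j.
Proof.
  assert (H : 0 < den j /\ 0 < den (S j)); [|apply H].
  induction j as [|j [IH1 IH2]]; [unfold den; simpl; lra|].
  split; [exact IH2|]. unfold den. rewrite cf_seq_rec. fold den.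
  pose proof (pos_INR j). pose proof (pow_lt (2 * INR j + 1) 4 ltac:(lra)).
  assert (0 < 44 * (INR j + 1) ^ 2 + 1) by nra. nra.
Qed.

(** Keeps all divisions in the tails genuine; index 0 is excluded because [b_cf 0] is negative. *)
Lemma cf_tail_pos m : forall k, (1 <= k)%nat -> 0 < cf_from a_cf b_cf k m.
Proof.
  assert (Ha : forall k, (1 <= k)%nat -> 0 < a_cf k).
  { intros k Hk. destruct k as [|[|k]]; [lia|simpl; lra|]. unfold a_cf.
    pose proof (pow2_ge_0 (INR (S (S k)))). lra. }
  assert (Hb : forall k, (1 <= k)%nat -> 0 < b_cf k).
  { intros k Hk. destruct k as [|k]; [lia|]. unfold b_cf. apply pow_lt.
    pose proof (pos_INR (S k)). lra. }
  induction m as [|m IH]; intros k Hk; simpl; [apply Ha, Hk|].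
  specialize (IH (S k) ltac:(lia)). specialize (Ha k Hk). specialize (Hb k Hk).
  pose proof (Rdiv_lt_0_compat _ _ Hb IH). lra.
Qed.

(** The factor [c] is a product of inner tails, the same for every solution, so it cancels in
    [num / den]. From index 2 on, [a_cf] follows the coefficients of [cf_rec]. *)
Lemma cf_tail_spec m : forall k, (2 <= k)%nat -> exists c, 0 < c /\ forall u, cf_rec u ->
  u (k + m + 1)%nat = c * (cf_from a_cf b_cf k m * u k + b_cf (k - 1) * u (k - 1)%nat).
Proof.
  assert (Hrec : forall k u, (2 <= k)%nat -> cf_rec u ->
    u (S k) = a_cf k * u k + b_cf (k - 1) * u (k - 1)%nat).
  { intros k u Hk Hu. destruct k as [|[|k]]; [lia|lia|].
    replace (S (S k) - 1)%nat with (S k) by lia. rewrite (Hu (S k)). unfold a_cf, b_cf.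
    rewrite !S_INR. ring. }
  induction m as [|m IH]; intros k Hk.
  - exists 1. split; [lra|]. intros u Hu.
    replace (k + 0 + 1)%nat with (S k) by lia. rewrite (Hrec k u Hk Hu). simpl. ring.
  - destruct (IH (S k) ltac:(lia)) as [c [Hc Hcu]].
    pose proof (cf_tail_pos m (S k) ltac:(lia)) as Hz.
    exists (c * cf_from a_cf b_cf (S k) m). split; [apply Rmult_lt_0_compat; assumption|].
    intros u Hu. specialize (Hcu u Hu).
    replace (k + S m + 1)%nat with (S k + m + 1)%nat by lia. rewrite Hcu.
    replace (S k - 1)%nat with k by lia. rewrite (Hrec k u Hk Hu). simpl cf_from.
    field. lra.
Qed.

Lemma convergent_num_den n : convergent a_cf b_cf n = num (S n) / den (S n).
Proof.
  unfold convergent. destruct n as [|[|n]].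
  - simpl. unfold num, den; simpl. field.
  - simpl. unfold num, den; simpl. field.
  - destruct (cf_tail_spec n 2 ltac:(lia)) as [c [Hc Hcu]].
    replace (2 + n + 1)%nat with (S (S (S n))) in Hcu by lia.
    unfold num, den. rewrite !Hcu by apply cf_seq_rec.
    pose proof (cf_tail_pos n 2 ltac:(lia)) as Hz.
    change (cf_from a_cf b_cf 0 (S (S n)))
      with (80 + -160 / (47 + b_cf 1 / cf_from a_cf b_cf 2 n)).
    set (z := cf_from a_cf b_cf 2 n) in *. unfold b_cf. simpl (2 - 1)%nat.
    simpl cf_seq. simpl INR. cbv iota beta. field. repeat split; nra.
Qed.

Fixpoint oddsq (j : nat) : R :=
  match j with O => 1 | S i => oddsq i * (2 * INR i + 1) ^ 2 end.

Lemma oddsq_S j : oddsq (S j) = oddsq j * (2 * INR j + 1) ^ 2.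
Proof. reflexivity. Qed.

Lemma oddsq_pos j : 0 < oddsq j.
Proof.
  induction j as [|j IH]; simpl; [lra|].
  apply Rmult_lt_0_compat; [exact IH|]. pose proof (pos_INR j). nra.
Qed.

(* Minimal since [sI j] decays like [golden ^ (- 5 j)]. *)
Definition minimal (j : nat) : R := (-1) ^ j * oddsq j * sI j.

Lemma minimal_rec : cf_rec minimal.
Proof.
  intros j. unfold minimal. rewrite !oddsq_S, S_INR, <- !(tech_pow_Rmult (-1)).
  pose proof (sI_rec j) as H.
  replace ((2 * (INR j + 1) + 1) ^ 2) with ((2 * INR j + 3) ^ 2) by ring.
  transitivity ((-1) ^ j * oddsq j * (2 * INR j + 1) ^ 2 *
    ((2 * INR j + 3) ^ 2 * sI (S (S j)))).
  - ring.
  - replace ((2 * INR j + 3) ^ 2 * sI (S (S j)))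
      with ((2 * INR j + 1) ^ 2 * sI j - (44 * (INR j + 1) ^ 2 + 1) * sI (S j)) by lra.
    ring.
Qed.

(** Each step multiplies the determinant by -(2j+1)^4. *)
Lemma casoratian j :
  den (S j) * minimal j - den j * minimal (S j)
  = (-1) ^ j * oddsq j ^ 2 * (sI 0 + 2 * sI 1).
Proof.
  induction j as [|j IH].
  - unfold den, minimal. simpl. ring.
  - rewrite minimal_rec. unfold den at 1. rewrite cf_seq_rec. fold den.
    replace (((44 * (INR j + 1) ^ 2 + 1) * den (S j) + (2 * INR j + 1) ^ 4 * den j)
        * minimal (S j) - den (S j) *
        ((44 * (INR j + 1) ^ 2 + 1) * minimal (S j) + (2 * INR j + 1) ^ 4 * minimal j))
      with (- (2 * INR j + 1) ^ 4 * (den (S j) * minimal j - den j * minimal (S j))) by ring.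
    rewrite IH, oddsq_S, <- (tech_pow_Rmult (-1)). ring.
Qed.

(* The quotient of a dominant solution of the recurrence by the minimal one. *)
Definition dom_ratio (j : nat) : R := den j / (oddsq j * sI j).

Lemma dom_ratio_pos j : 0 < dom_ratio j.
Proof.
  apply Rdiv_lt_0_compat; [apply den_pos|].
  apply Rmult_lt_0_compat; [apply oddsq_pos|apply sI_pos].
Qed.

(** The Casoratian divided by both minimal solutions; [dom_ratio] omits their alternating sign,
    which turns the difference into a sum. *)
Lemma dom_ratio_step j : dom_ratio (S j) + dom_ratio j
  = (sI 0 + 2 * sI 1) / ((2 * INR j + 1) ^ 2 * (sI j * sI (S j))).
Proof.
  pose proof (casoratian j) as H. unfold minimal in H.
  rewrite oddsq_S, <- (tech_pow_Rmult (-1)) in H. unfold dom_ratio. rewrite oddsq_S.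
  pose proof (oddsq_pos j). pose proof (sI_pos j). pose proof (sI_pos (S j)).
  pose proof (pos_INR j).
  assert (Hs : (-1) ^ j <> 0) by (apply pow_nonzero; lra).
  set (o := oddsq j) in *. set (A := sI j) in *. set (B := sI (S j)) in *.
  set (x := INR j) in *.
  assert (HE : den (S j) * A + den j * ((2 * x + 1) ^ 2 * B) = o * (sI 0 + 2 * sI 1)).
  { apply Rmult_eq_reg_l with ((-1) ^ j * o);
      [|apply Rmult_integral_contrapositive_currified; lra].
    transitivity (den (S j) * ((-1) ^ j * o * A)
       - den j * (-1 * (-1) ^ j * (o * (2 * x + 1) ^ 2) * B)); [ring|].
    refine (eq_trans _ (eq_trans H _)); ring. }
  apply Rmult_eq_reg_r with (o * (2 * x + 1) ^ 2 * A * B).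
  - transitivity (den (S j) * A + den j * ((2 * x + 1) ^ 2 * B)).
    + field. repeat split; lra.
    + rewrite HE. field. repeat split; lra.
  - assert (0 < o * (2 * x + 1) ^ 2 * A * B); [|lra].
    repeat apply Rmult_lt_0_compat; try assumption; lra.
Qed.

Lemma contraction_lim (y r : nat -> R) (p : R) : 1 < p ->
  (forall j, 0 <= y j) -> (forall j, p * y (S j) <= y j + r j) ->
  is_lim_seq r 0 -> is_lim_seq y 0.
Proof.
  intros Hp Hy Hr Hlim. apply is_lim_seq_spec. intros [eps Heps]. simpl.
  (* Chosen so that [eps / 2] is the fixed point of y -> (y + eps (p - 1)/2) / p. *)
  assert (Hd : 0 < eps * (p - 1) / 2) by nra.
  apply is_lim_seq_spec in Hlim. destruct (Hlim (mkposreal _ Hd)) as [J HJ]. simpl in HJ.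
  assert (Hi : forall i, y (J + i)%nat <= (/ p) ^ i * y J + eps / 2).
  { induction i as [|i IH].
    - rewrite Nat.add_0_r. simpl. lra.
    - rewrite Nat.add_succ_r. specialize (Hr (J + i)%nat).
      specialize (HJ (J + i)%nat ltac:(lia)). rewrite Rminus_0_r in HJ.
      apply Rabs_def2 in HJ. simpl.
      apply Rmult_le_reg_l with p; [lra|].
      replace (p * (/ p * (/ p) ^ i * y J + eps / 2))
        with ((/ p) ^ i * y J + eps / 2 + eps * (p - 1) / 2) by (field; lra).
      lra. }
  assert (Hg : is_lim_seq (fun i => (/ p) ^ i * y J) 0).
  { replace (Finite 0) with (Rbar_mult 0 (y J)) by (simpl; f_equal; ring).
    apply is_lim_seq_scal_r, is_lim_seq_geom.
    rewrite Rabs_pos_eq by (apply Rlt_le, Rinv_0_lt_compat; lra).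
    rewrite <- Rinv_1. apply Rinv_lt_contravar; lra. }
  apply is_lim_seq_spec in Hg.
  destruct (Hg (mkposreal (eps / 2) ltac:(lra))) as [I HI]. simpl in HI.
  exists (J + I)%nat. intros n Hn. specialize (HI (n - J)%nat ltac:(lia)).
  specialize (Hi (n - J)%nat). replace (J + (n - J))%nat with n in Hi by lia.
  rewrite Rminus_0_r in *. apply Rabs_def2 in HI. specialize (Hy n).
  apply Rabs_def1; lra.
Qed.

(** The distance to the fixed point [l / (p + 1)] shrinks by the factor 1/p at each step, up to an
    error tending to 0. *)
Lemma affine_rec_lim (x s : nat -> R) (p l : R) : 1 < p ->
  (forall j, p * x (S j) + x j = s j) -> is_lim_seq s l -> is_lim_seq x (l / (p + 1)).
Proof.
  intros Hp Hx Hs. set (m := l / (p + 1)).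
  assert (Hm : p * m + m = l) by (unfold m; field; lra).
  assert (H : is_lim_seq (fun j => Rabs (x j - m)) 0).
  { apply contraction_lim with (fun j => Rabs (s j - l)) p; [exact Hp| | |].
    - intros; apply Rabs_pos.
    - intros j. rewrite <- (Rabs_pos_eq p) at 1 by lra. rewrite <- Rabs_mult.
      replace (p * (x (S j) - m)) with (- (x j - m) + (s j - l)) by (rewrite <- (Hx j); lra).
      refine (Rle_trans _ _ _ (Rabs_triang _ _) _). rewrite Rabs_Ropp. lra.
    - apply is_lim_seq_abs_0 with (u := fun j => s j - l).
      replace (Finite 0) with (Finite (l - l)) by (f_equal; ring).
      apply is_lim_seq_minus'; [exact Hs|apply is_lim_seq_const]. }
  apply is_lim_seq_abs_0 in H.
  apply is_lim_seq_ext with (fun j => (x j - m) + m); [intros; ring|].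
  replace (Finite m) with (Finite (0 + m)) by (f_equal; ring).
  apply is_lim_seq_plus'; [exact H|apply is_lim_seq_const].
Qed.

Lemma Gamma_quarter_ratio : Gamma (1 / 4) / Gamma (3 / 4) = gratio 0.
Proof.
  unfold gratio. simpl INR. replace (0 / 2 + 1 / 4) with (1 / 4) by field.
  replace (0 / 2 + 3 / 4) with (3 / 4) by field. reflexivity.
Qed.

(** The Gamma values enter here: [sX 0] and [sX 1] are proportional to the squares of [gratio 0] and
    [4 / gratio 0], and 5 * 16 = 80. *)
Lemma sI_initial : sI 0 + 2 * sI 1 = 80 * sI 0 / gratio 0 ^ 4.
Proof.
  destruct stirling_rem_cv as [c Hc].
  pose proof sI_sX_1 as H1. pose proof sI_sX_0 as H0.
  rewrite (sX_gratio c Hc 1) in H1. rewrite (sX_gratio c Hc 0) in H0.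
  pose proof gratio_0_1 as Hg. pose proof (gratio_pos 0) as Hp.
  assert (Hg1 : gratio 1 = 4 / gratio 0).
  { apply Rmult_eq_reg_l with (gratio 0); [|lra]. rewrite Hg. field. lra. }
  rewrite Hg1 in H1. rewrite H0 in *.
  transitivity (5 * (exp (- (2 * c)) * (4 / gratio 0) ^ 2)); [lra|]. field. lra.
Qed.

(** Two solutions of one second-order recurrence: at 0 they agree by normalization, at 1 by
    [sI_initial]. *)
Lemma num_den_minimal j :
  num j - gratio 0 ^ 4 * den j = - (2 * gratio 0 ^ 4 / sI 0) * minimal j.
Proof.
  pose proof (sI_pos 0) as Hs. pose proof (gratio_pos 0) as Hg.
  pose proof sI_initial as Hi. set (G := gratio 0 ^ 4) in *.
  assert (HG : 0 < G) by (apply pow_lt; exact Hg).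
  apply (cf_rec_unique (fun j => num j - G * den j) (fun j => - (2 * G / sI 0) * minimal j)).
  - intros i. unfold num, den. rewrite !cf_seq_rec. ring.
  - intros i. rewrite minimal_rec. ring.
  - unfold num, den, minimal. simpl. field. lra.
  - assert (H1 : 2 * sI 1 = 80 * sI 0 / G - sI 0) by lra.
    unfold num, den, minimal. simpl cf_seq. simpl oddsq. simpl pow. simpl INR.
    transitivity (G / sI 0 * (2 * sI 1)); [rewrite H1; field; lra|field; lra].
Qed.

Lemma dom_ratio_asymp :
  is_lim_seq (fun j => dom_ratio j / golden ^ (10 * j)) (/ (4 * sI 0)).
Proof.
  destruct stirling_rem_cv as [c Hc].
  pose proof (sI_asymp c Hc) as HI. pose proof (sI_const_sq c) as HK.
  pose proof sI_initial as Hi. pose proof (gratio_pos 0) as Hg0. pose proof (sI_pos 0) as Hs0.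
  pose proof sI_sX_0 as Hx0. rewrite (sX_gratio c Hc 0) in Hx0.
  pose proof golden_bounds as Hg. pose proof rt5_bounds as Hrb. pose proof rt5_sq as Hr.
  pose proof golden_pow5 as Hp5.
  set (w := sI 0 + 2 * sI 1) in *. set (K := sI_const c) in *.
  assert (HK0 : 0 < K) by apply exp_pos.
  assert (Hw0 : 0 < w) by (pose proof (sI_pos 1); unfold w; lra).
  assert (Hgp : forall i, 0 < golden ^ i) by (intros; apply pow_lt; lra).
  assert (Hlim : is_lim_seq (fun j => w / ((2 * INR j + 1) ^ 2 * (sI j * sI (S j)) * golden ^ (10 * j)))
                  (w * golden ^ 5 / (4 * (K * K)))).
  { apply is_lim_seq_incr_1.
    set (J := fun n => INR n * golden ^ (5 * n) * sI n) in HI.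
    assert (HJ1 : is_lim_seq (fun j => J (S j)) K) by (apply (is_lim_seq_incr_1 J), HI).
    assert (HJ2 : is_lim_seq (fun j => J (S (S j))) K)
      by (apply (is_lim_seq_incr_1 (fun j => J (S j))), HJ1).
    assert (HJ : forall n, (0 < n)%nat -> 0 < J n).
    { intros n Hn. unfold J. repeat apply Rmult_lt_0_compat;
        [apply lt_0_INR, Hn|apply Hgp|apply sI_pos]. }
    assert (Hv : is_lim_seq (fun j => / INR (S j)) 0)
      by (apply (is_lim_seq_incr_1 (fun j => / INR j)), is_lim_seq_inv_INR).
    apply is_lim_seq_ext with (fun j =>
      w * golden ^ 5 * (1 + / INR (S j)) / ((2 + / INR (S j)) ^ 2 * (J (S j) * J (S (S j))))).
    - intros j. unfold J. rewrite (S_INR (S j)).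
      replace (5 * S (S j))%nat with (5 * S j + 5)%nat by lia.
      replace (10 * S j)%nat with (5 * S j + 5 * S j)%nat by lia.
      rewrite !pow_add.
      pose proof (Hgp (5 * S j)%nat) as H1. pose proof (Hgp 5%nat) as H2.
      pose proof (sI_pos (S j)). pose proof (sI_pos (S (S j))).
      pose proof (lt_0_INR (S j) ltac:(lia)) as Hx.
      set (P := golden ^ (5 * S j)) in *. set (P5 := golden ^ 5) in *.
      set (x := INR (S j)) in *. field. repeat split; lra.
    - replace (w * golden ^ 5 / (4 * (K * K)))
        with (w * golden ^ 5 * (1 + 0) / ((2 + 0) * (2 + 0) * (K * K))) by (field; lra).
      apply is_lim_seq_ext with (fun j => w * golden ^ 5 * (1 + / INR (S j))
         / ((2 + / INR (S j)) * (2 + / INR (S j)) * (J (S j) * J (S (S j))))).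
      { intros j. f_equal. f_equal. ring. }
      apply is_lim_seq_div'.
      + apply is_lim_seq_mult'; [apply is_lim_seq_const|].
        apply is_lim_seq_plus'; [apply is_lim_seq_const|exact Hv].
      + apply is_lim_seq_mult'; apply is_lim_seq_mult'; try assumption;
          apply is_lim_seq_plus'; try assumption; apply is_lim_seq_const.
      + assert (0 < K * K) by nra. lra. }
  assert (Hp10 : golden ^ 10 = golden ^ 5 * golden ^ 5) by (rewrite <- pow_add; reflexivity).
  (* Equivalent to golden^5 + golden^(-5) = 5 sqrt 5; it removes golden^5 from the limit. *)
  assert (Hp10' : golden ^ 10 + 1 = golden ^ 5 * (5 * rt5)).
  { rewrite Hp10, Hp5. replace ((11 + 5 * rt5) / 2 * ((11 + 5 * rt5) / 2) + 1)
      with ((125 + 110 * rt5 + 25 * rt5 ^ 2) / 4) by field.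
    replace ((11 + 5 * rt5) / 2 * (5 * rt5)) with ((55 * rt5 + 25 * rt5 ^ 2) / 2) by field.
    rewrite Hr. field. }
  replace (/ (4 * sI 0)) with (w * golden ^ 5 / (4 * (K * K)) / (golden ^ 10 + 1)).
  - apply affine_rec_lim with
      (fun j => w / ((2 * INR j + 1) ^ 2 * (sI j * sI (S j)) * golden ^ (10 * j))).
    + rewrite Hp10, Hp5. nra.
    + intros j. rewrite <- (Rmult_1_r (dom_ratio j / _)).
      pose proof (dom_ratio_step j) as Hst. fold w in Hst.
      replace (10 * S j)%nat with (10 + 10 * j)%nat by lia. rewrite pow_add.
      pose proof (Hgp 10%nat) as H1. pose proof (Hgp (10 * j)%nat) as H2.
      pose proof (sI_pos j). pose proof (sI_pos (S j)). pose proof (pos_INR j).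
      set (P := golden ^ (10 * j)) in *. set (P10 := golden ^ 10) in *.
      transitivity ((dom_ratio (S j) + dom_ratio j) / P); [field; lra|].
      rewrite Hst. field. repeat split; lra.
    + exact Hlim.
  (* The Stirling constant cancels: K^2 contains E^2, and E^2 g^4 = [sI 0 ^ 2]. *)
  - rewrite Hp10', Hi.
    replace (K * K) with (K ^ 2) by ring. rewrite HK.
    rewrite Hx0. pose proof (exp_pos (- (2 * c))) as He.
    pose proof (Hgp 5%nat) as H5.
    set (E := exp (- (2 * c))) in *. set (P5 := golden ^ 5) in *. set (g := gratio 0) in *.
    apply Rmult_eq_reg_r with (rt5 ^ 2); [|lra].
    rewrite Hr at 2. field. repeat split; lra.
Qed.

Lemma convergent_error n : gratio 0 ^ 4 - convergent a_cf b_cf n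
  = (-1) ^ (n + 1) * (2 * gratio 0 ^ 4 / sI 0) / dom_ratio (S n).
Proof.
  rewrite convergent_num_den. pose proof (num_den_minimal (S n)) as H.
  pose proof (den_pos (S n)). pose proof (sI_pos 0). pose proof (sI_pos (S n)).
  pose proof (oddsq_pos (S n)).
  replace (num (S n)) with (gratio 0 ^ 4 * den (S n)
     + - (2 * gratio 0 ^ 4 / sI 0) * minimal (S n)) by (rewrite <- H; ring).
  unfold dom_ratio, minimal. replace (n + 1)%nat with (S n) by lia.
  field. repeat split; lra.
Qed.

Theorem theorem2p1 :
  let G := (Gamma (1/4) / Gamma (3/4)) ^ 4 in
  is_lim_seq (fun n => convergent a_cf b_cf n) (Finite G) /\
  is_lim_seq
    (fun n => (G - convergent a_cf b_cf n) /
              ((-1) ^ (n + 1) * (8 * G) / golden ^ (10 * n + 10)))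
    (Finite 1).
Proof.
  cbv zeta. rewrite Gamma_quarter_ratio.
  pose proof (gratio_pos 0) as Hg. pose proof (sI_pos 0) as Hs. pose proof golden_bounds as Hgo.
  set (G := gratio 0 ^ 4) in *. assert (HG : 0 < G) by (apply pow_lt; exact Hg).
  assert (Hgp : forall i, 0 < golden ^ i) by (intros; apply pow_lt; lra).
  assert (Hsign : forall i, (-1) ^ i <> 0) by (intros; apply pow_nonzero; lra).
  set (x := fun j => dom_ratio j / golden ^ (10 * j)).
  assert (Hx : is_lim_seq (fun n => x (S n)) (/ (4 * sI 0)))
    by (apply (is_lim_seq_incr_1 x), dom_ratio_asymp).
  assert (Hratio : is_lim_seq (fun n => (G - convergent a_cf b_cf n) /
              ((-1) ^ (n + 1) * (8 * G) / golden ^ (10 * n + 10))) 1).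
  (* By [convergent_error] the quotient is exactly the limit of [x] divided by [x (S n)], as 2/8 =
     1/4. *)
  { apply is_lim_seq_ext with (fun n => / (4 * sI 0) / x (S n)).
    - intros n. unfold G at 1. rewrite convergent_error. fold G. unfold x.
      replace (10 * S n)%nat with (10 * n + 10)%nat by lia.
      pose proof (dom_ratio_pos (S n)). pose proof (Hgp (10 * n + 10)%nat).
      pose proof (Hsign (n + 1)%nat). field. repeat split; lra.
    - replace (Finite 1) with (Finite (/ (4 * sI 0) / / (4 * sI 0))) by (f_equal; field; lra).
      apply is_lim_seq_div'; [apply is_lim_seq_const|exact Hx|].
      apply Rinv_neq_0_compat. lra. }
  split; [|exact Hratio].
  (* The predicted error decays geometrically, so the true error, its product with a quotient
     tending to 1, vanishes as well. *)
  assert (Hscale : is_lim_seq (fun n => (-1) ^ (n + 1) * (8 * G) / golden ^ (10 * n + 10)) 0).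
  { apply is_lim_seq_abs_0.
    apply is_lim_seq_ext with (fun n => 8 * G / golden ^ 10 * (/ golden ^ 10) ^ n).
    - intros n. unfold Rdiv. rewrite !Rabs_mult, pow_1_abs, Rabs_inv.
      rewrite (Rabs_pos_eq 8), (Rabs_pos_eq G), (Rabs_pos_eq (golden ^ _)) by
        (try lra; apply Rlt_le, Hgp).
      rewrite pow_add, pow_mult, pow_inv.
      pose proof (Hgp 10%nat). pose proof (pow_lt _ n (Hgp 10%nat)). field. split; lra.
    - replace (Finite 0) with (Rbar_mult (8 * G / golden ^ 10) 0) by (simpl; f_equal; ring).
      apply is_lim_seq_scal_l, is_lim_seq_geom.
      rewrite Rabs_pos_eq by (apply Rlt_le, Rinv_0_lt_compat, Hgp).
      rewrite <- Rinv_1. apply Rinv_lt_contravar; [rewrite Rmult_1_l; apply Hgp|].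
      apply Rlt_pow_R1; [lra|lia]. }
  pose proof (is_lim_seq_mult' _ _ _ _ Hratio Hscale) as Hprod.
  apply is_lim_seq_ext with (fun n => G -
    (G - convergent a_cf b_cf n) / ((-1) ^ (n + 1) * (8 * G) / golden ^ (10 * n + 10))
    * ((-1) ^ (n + 1) * (8 * G) / golden ^ (10 * n + 10))).
  - intros n. pose proof (Hgp (10 * n + 10)%nat). pose proof (Hsign (n + 1)%nat).
    field. repeat split; lra.
  - replace (Finite G) with (Finite (G - 1 * 0)) by (f_equal; ring).
    apply is_lim_seq_minus'; [apply is_lim_seq_const|exact Hprod].
Qed.
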